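(* Let $\mathcal{X}$ be an instance of the resource sharing problem (as described in the context) and let $\delta\in(0,1]$. One can compute a primal solution $x\in\mathcal{X}$ and a dual solution $z\in\Delta_m$ satisfying \[\|x\|_\infty\le(1+\delta)\sigma\lambda^*,\qquad \min_{x'\in\mathcal{X}}\langle z,x'\rangle\ge(1-\delta)\frac{\lambda^*}{\sigma},\] and \[\max_{r\in S}x_r\le\mu+\delta\max\{\lambda^*,\mu\}\quad\text{for all } S\subseteq\mathcal{R},\ \mu\ge 0 \text{ such that } \mathcal{X} \text{ satisfies local weak duality w.r.t. } S \text{ and } \mu,\] using $\mathcal{O}\!\left(\frac{n+m}{\delta^2}\log m\right)$ oracle calls and further operations taking polynomial time.
   Context: Resource sharing problem: $\mathcal{C}$ (customers) and $\mathcal{R}$ (resources) are finite sets, $n=|\mathcal{C}|$, $m=|\mathcal{R}|$. For each $C\in\mathcal{C}$, $X_C\subseteq\mathbb{R}^{\mathcal{R}}_{\ge0}$ is a nonempty closed convex set, and $\mathcal{X}=\sum_{C\in\mathcal{C}}X_C$ is their Minkowski sum. For $y\in\mathbb{R}^m_{\ge0}$ let $opt_C(y)=\min_{x\in X_C}\langle y,x\rangle$. A constant $\sigma\ge1$ is fixed (regarded as a constant in the $\mathcal{O}$-notation), and for each $C$ an oracle (block solver) $f_C:\mathbb{R}^m_{\ge0}\to X_C$ is given with $\langle y,f_C(y)\rangle\le\sigma\,opt_C(y)$ for all $y\in\mathbb{R}^m_{\ge0}$; one evaluation of some $f_C$ is an oracle call. $\lambda^*=\min_{x\in\mathcal{X}}\|x\|_\infty$.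 $\Delta_m=\{p\in[0,1]^m:\|p\|_1=1\}$. The instance satisfies local weak duality w.r.t. $S\subseteq\mathcal{R}$ and $\mu\ge0$ if for every family $(y^{(C)})_{C\in\mathcal{C}}$ of vectors in $\mathbb{R}^m_{\ge0}$, $\sum_{C\in\mathcal{C}}\sum_{r\in S}y^{(C)}_r f_C(y^{(C)})_r\le\mu\sum_{r\in S}\max_{C\in\mathcal{C}}y^{(C)}_r$. *)

(* Defs.v *)
From HB Require Import structures.
From mathcomp Require Import all_boot all_order all_algebra.
From mathcomp Require Import all_classical all_reals all_analysis.

Set Implicit Arguments.
Unset Strict Implicit.
Unset Printing Implicit Defensive.

Import Order.TTheory GRing.Theory Num.Theory.
Import numFieldNormedType.Exports.

Local Open Scope classical_set_scope.
Local Open Scope ring_scope.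

(* Customers are 'I_n and resources are 'I_m; the norm `|x| that the library  *)
(* puts on 'rV[R]_m is the sup norm.                                          *)

Section ResourceSharing.
Variables (R : realType) (n m : nat).
Implicit Types (X : 'I_n -> set 'rV[R]_m) (f : 'I_n -> 'rV[R]_m -> 'rV[R]_m).
Implicit Types (x y z : 'rV[R]_m).

Definition dotr y x : R := \sum_(r < m) y 0 r * x 0 r.

Definition nonneg_vec x : Prop := forall r, 0 <= x 0 r.

Definition rs_instance X : Prop :=
  forall C, [/\ X C !=set0, closed (X C), convex_set (X C)
              & X C `<=` nonneg_vec].

Definition minkowski_sum X : set 'rV[R]_m :=
  [set x | exists2 g : 'I_n -> 'rV[R]_m,
             forall C, X C (g C) & x = \sum_C g C].

(* Minima are rendered by inf. Under rs_instance the sets concerned are       *)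
(* nonempty and bounded below by 0, and inf is the minimum whenever the       *)
(* minimum exists (it always does for lambda_star; for a linear form it need  *)
(* not, as X C may be unbounded).                                             *)
Definition min_dot (A : set 'rV[R]_m) y : R := inf [set dotr y x | x in A].

Definition opt X (C : 'I_n) y : R := min_dot (X C) y.

Definition lambda_star X : R := inf [set `|x| | x in minkowski_sum X].

Definition block_solver (sigma : R) X f : Prop :=
  forall C y, nonneg_vec y ->
    X C (f C y) /\ dotr y (f C y) <= sigma * opt X C y.

Definition simplex : set 'rV[R]_m :=
  [set p | (forall r, 0 <= p 0 r <= 1) /\ \sum_(r < m) `|p 0 r| = 1].

(* The default value 0 of the maximum over customers only matters for n = 0.  *)
Definition local_weak_duality f (S : {set 'I_m}) (mu : R) : Prop :=
  forall y : 'I_n -> 'rV[R]_m, (forall C, nonneg_vec (y C)) ->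
    \sum_C \sum_(r in S) y C 0 r * f C (y C) 0 r
      <= mu * \sum_(r in S) \big[Num.max/0]_C y C 0 r.

End ResourceSharing.

(* Computation model: a uniform real random-access machine with an oracle,    *)
(* given as a while language. The memory has natural-number registers, with   *)
(* addition and truncated subtraction only (so that unit cost is not abused), *)
(* and real arrays, with exact field operations and comparisons. A program    *)
(* contains no real constants other than numerals.                            *)
Inductive iexpr : Type :=
| ICst of nat
| IVar of nat
| IAdd of iexpr & iexpr
| ISub of iexpr & iexpr.

Inductive rexpr : Type :=
| RCst of nat
| RGet of nat & iexpr
| RAdd of rexpr & rexpr
| RSub of rexpr & rexpr
| RMul of rexpr & rexpr
| RDiv of rexpr & rexpr.

Inductive bexpr : Type :=
| BILt of iexpr & iexpr
| BRLt of rexpr & rexpr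
| BNot of bexpr
| BAnd of bexpr & bexpr.

(* Call e q a passes the first m entries of array q to the oracle of customer *)
(* number e and overwrites the first m entries of array a by the answer.      *)
Inductive cmd : Type :=
| Skip
| ISet of nat & iexpr
| RSet of nat & iexpr & rexpr
| Seq of cmd & cmd
| If of bexpr & cmd & cmd
| While of bexpr & cmd
| Call of iexpr & nat & nat.

Section Semantics.
Variables (R : realType) (n m : nat) (f : 'I_n -> 'rV[R]_m -> 'rV[R]_m).

Record state : Type := State { ivar : nat -> nat; rmem : nat -> nat -> R }.

Definition set_ivar (s : state) (v k : nat) : state :=
  State (fun w => if w == v then k else ivar s w) (rmem s).

Definition set_rmem (s : state) (a i : nat) (u : R) : state :=
  State (ivar s)
    (fun b j => if (b == a) && (j == i) then u else rmem s b j).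

Definition read_vec (s : state) (a : nat) : 'rV[R]_m :=
  \row_(r < m) rmem s a r.

Definition write_vec (s : state) (a : nat) (v : 'rV[R]_m) : state :=
  State (ivar s)
    (fun b j => if b == a then
                  if insub j is Some r then v 0 (r : 'I_m) else rmem s b j
                else rmem s b j).

Fixpoint ieval (s : state) (e : iexpr) : nat :=
  match e with
  | ICst k => k
  | IVar v => ivar s v
  | IAdd e1 e2 => (ieval s e1 + ieval s e2)%N
  | ISub e1 e2 => (ieval s e1 - ieval s e2)%N
  end.

Fixpoint reval (s : state) (e : rexpr) : R :=
  match e with
  | RCst k => k%:R
  | RGet a i => rmem s a (ieval s i)
  | RAdd e1 e2 => reval s e1 + reval s e2
  | RSub e1 e2 => reval s e1 - reval s e2
  | RMul e1 e2 => reval s e1 * reval s e2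
  | RDiv e1 e2 => reval s e1 / reval s e2
  end.

Fixpoint beval (s : state) (b : bexpr) : bool :=
  match b with
  | BILt e1 e2 => (ieval s e1 < ieval s e2)%N
  | BRLt e1 e2 => reval s e1 < reval s e2
  | BNot b1 => ~~ beval s b1
  | BAnd b1 b2 => beval s b1 && beval s b2
  end.

(* exec c s s' t q: started in s, c halts in s' after t elementary steps, of  *)
(* which q are oracle calls. One step is charged per command and per test;    *)
(* the expressions evaluated in a step have a size fixed by the program. A    *)
(* call to a nonexistent customer or with a negative price is stuck.          *)
Inductive exec : cmd -> state -> state -> nat -> nat -> Prop :=
| ExecSkip s : exec Skip s s 1 0
| ExecISet s v e : exec (ISet v e) s (set_ivar s v (ieval s e)) 1 0
| ExecRSet s a i e :
    exec (RSet a i e) s (set_rmem s a (ieval s i) (reval s e)) 1 0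
| ExecSeq c1 c2 s s1 s2 t1 t2 q1 q2 :
    exec c1 s s1 t1 q1 -> exec c2 s1 s2 t2 q2 ->
    exec (Seq c1 c2) s s2 (t1 + t2) (q1 + q2)
| ExecIfTrue b c1 c2 s s' t q :
    beval s b -> exec c1 s s' t q -> exec (If b c1 c2) s s' t.+1 q
| ExecIfFalse b c1 c2 s s' t q :
    ~~ beval s b -> exec c2 s s' t q -> exec (If b c1 c2) s s' t.+1 q
| ExecWhileFalse b c s : ~~ beval s b -> exec (While b c) s s 1 0
| ExecWhileTrue b c s s1 s2 t1 t2 q1 q2 :
    beval s b -> exec c s s1 t1 q1 -> exec (While b c) s1 s2 t2 q2 ->
    exec (While b c) s s2 (t1 + t2).+1 (q1 + q2)
| ExecCall e q a s (C : 'I_n) :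
    ieval s e = C -> nonneg_vec (read_vec s q) ->
    exec (Call e q a) s (write_vec s a (f C (read_vec s q))) 1 1.

(* Registers 0 and 1 hold n and m, entry 0 of array 0 holds delta, and the    *)
(* rest of the memory is 0.                                                   *)
Definition init_state (delta : R) : state :=
  State (fun v => match v with 0%N => n | 1%N => m | _ => 0%N end)
        (fun a i => if (a == 0%N) && (i == 0%N) then delta else 0).

(* On input n, m, delta and with oracle access to f, the program P returns x  *)
(* in array 1 and z in array 2, within t steps of which q are oracle calls.   *)
Definition computes (P : cmd) (delta : R) (x z : 'rV[R]_m) (t q : nat) : Prop :=
  exists s : state, [/\ exec P (init_state delta) s t q,
                        x = read_vec s 1 & z = read_vec s 2].

End Semantics.

(* Main.v *)
Require Import Defs.
From mathcomp Require Import all_boot all_order all_algebra.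
From mathcomp Require Import all_classical all_reals all_analysis.
From mathcomp Require Import ring lra zify.

(** A multiplicative-weights scheme. Prices y start at 1; a phase gives every
    customer C the total weight w, in steps: C answers b = f_C(y), a step size
    xi <= 1 / max_r b_r is chosen, the load x grows by xi b and y_r is multiplied
    by 1 + eps xi b_r. Since y only grows within a phase, local weak duality
    w.r.t. (S, mu) bounds the growth of sum_(r in S) y_r over a phase by the
    factor 1 / (1 - eps w mu), whereas y_r >= exp (eps / (1 + eps) x_r);
    comparing the two bounds x_r / W for r in S, where W is the total weight.
    The bound on the maximum norm is the case of S = all resources and
    mu = sigma lambda_star. The dual solution is the normalised price vector after
    the phase in which the sum of the prices grew by the largest factor. A step
    that does not finish its customer increases some load by 1, so the loads
    also bound the number of calls.

    The weight w must be of order 1 / lambda_star. To find it without a logarithmic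
    loss, the scheme is first run with eps = 1, starting from a w that is too
    large by a factor O(m); a phase in which the sum of the prices more than
    doubles is aborted, which certifies that w is too large, and w is halved
    while prices and loads are kept. This stops when W >= w log m: there are
    only O(log m) aborted phases, and the loads being O(log m) then show that
    w = O(1 / lambda_star). *)

Set Implicit Arguments.
Unset Strict Implicit.
Unset Printing Implicit Defensive.

Import Order.TTheory GRing.Theory Num.Theory.
Import numFieldNormedType.Exports.

Local Open Scope classical_set_scope.
Local Open Scope ring_scope.

(** * Elementary bounds on exponentials and logarithms *)

Section RealFacts.
Variable R : realType.
Implicit Types e a t : R.

(** The rate [h = e / (1 + e)] absorbs the loss in [expR (h * a) <= 1 / (1 - h * a)]: since
    [h * (1 + e) = e], the product [(1 + e * a) * (1 - h * a)] equals [1 + a * h * e * (1 - a)],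
    which is at least 1. *)
Lemma expR_le_1Dmul e a : 0 < e -> 0 <= a <= 1 ->
  expR (e / (1 + e) * a) <= 1 + e * a.
Proof.
move=> e0 /andP[a0 a1].
have e1 : 1 + e != 0 by rewrite gt_eqF//; lra.
set h := e / (1 + e); have hE : h * (1 + e) = e by rewrite /h divfK.
have h0 : 0 < h by rewrite /h divr_gt0//; lra.
have h1 : h < 1 by rewrite /h ltr_pdivrMr; lra.
have ha1 : h * a < 1 by nra.
have hN : 1 - h * a <= expR (- (h * a)) by exact: expR_ge1Dx.
have p0 : 0 < 1 - h * a by lra.
have -> : expR (h * a) = (expR (- (h * a)))^-1 by rewrite expRN invrK.
apply: (@le_trans _ _ (1 - h * a)^-1).
  by rewrite lef_pV2 // posrE expR_gt0.
rewrite -div1r ler_pdivrMr //.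
have -> : (1 + e * a) * (1 - h * a) = 1 + a * (e - h * (1 + e) + h * e * (1 - a)).
  ring.
rewrite hE subrr add0r lerDl mulr_ge0 // mulr_ge0 ?subr_ge0 // mulr_ge0 //; exact/ltW.
Qed.

(** Since [1 / (1 - t) = 1 + t / (1 - t)]. Turns the growth factor of a phase into an exponential,
    so that the factors of successive phases add up in the exponent. *)
Lemma expR_ge_invB t : t < 1 -> (1 - t)^-1 <= expR (t / (1 - t)).
Proof.
move=> t1; apply: le_trans (expR_ge1Dx _).
have n0 : 1 - t != 0 by rewrite gt_eqF//; lra.
by rewrite le_eqVlt; apply/orP; left; apply/eqP; field.
Qed.

Lemma ln2_ge : 2^-1 <= ln 2 :> R.
Proof.
rewrite -ler_expR lnK ?posrE //.
rewrite -[leLHS]invrK -[leRHS]invrK -expRN lef_pV2 ?posrE ?expR_gt0 ?invr_gt0 //.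
by apply: le_trans (expR_ge1Dx _); lra.
Qed.

(** Links the integer logarithm computed by the program to [ln], by [2 <= expR 1]. *)
Lemma nat_le_expR (k l : nat) : (k <= 2 ^ l)%N -> k%:R <= expR l%:R :> R.
Proof.
move=> kl; apply: (@le_trans _ _ (2 ^ l)%:R); first by rewrite ler_nat.
rewrite natrX -[l%:R]mulr1 expRM_natl lerXn2r ?nnegrE ?expR_ge0 //.
by have := expR_ge1Dx (1 : R); rewrite -natr1.
Qed.

End RealFacts.

(** * Block optima, weak duality and dilated convex sets *)

Section Geometry.
Variables (R : realType) (n m : nat).
Variables (X : 'I_n -> set 'rV[R]_m) (f : 'I_n -> 'rV[R]_m -> 'rV[R]_m).
Variable sigma : R.
Hypothesis hX : rs_instance X.
Hypothesis hf : block_solver sigma X f.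
Hypothesis hsigma : 1 <= sigma.
Implicit Types (x y z b : 'rV[R]_m) (A : set 'rV[R]_m).

Lemma norm_ge_coord x (r : 'I_m) : `|x 0 r| <= `|x|.
Proof.
rewrite [leRHS]/Num.norm /= mx_normrE.
exact: (le_bigmax _ (fun ij : 'I_1 * 'I_m => `|x ij.1 ij.2|) (0, r)).
Qed.

Lemma norm_le_coord x (e : R) : 0 <= e -> (forall r, `|x 0 r| <= e) -> `|x| <= e.
Proof.
move=> e0 h; rewrite [leLHS]/Num.norm /= mx_normrE.
by apply/bigmax_leP; split => // -[i j] _ /=; rewrite (ord1 i).
Qed.

Lemma X_ge0 C x : X C x -> nonneg_vec x.
Proof. by move=> h r; have [_ _ _] := hX C; apply. Qed.

Lemma dotr_ge0 y x : nonneg_vec y -> nonneg_vec x -> 0 <= dotr y x.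
Proof. by move=> hy hx; apply: sumr_ge0 => r _; rewrite mulr_ge0. Qed.

Lemma opt_le C y x : nonneg_vec y -> X C x -> opt X C y <= dotr y x.
Proof.
move=> hy hx; apply: ge_inf; last by exists x.
by exists 0 => _ [x' /X_ge0 hx' <-]; exact: dotr_ge0.
Qed.

Lemma le_opt C y (e : R) :
  (forall x, X C x -> e <= dotr y x) -> e <= opt X C y.
Proof.
move=> h; apply: lb_le_inf; last by move=> _ [x hx <-]; exact: h.
by have [[x hx] _ _ _] := hX C; exists (dotr y x), x.
Qed.

Lemma opt_ge0 C y : nonneg_vec y -> 0 <= opt X C y.
Proof. by move=> hy; apply: le_opt => x /X_ge0; exact: dotr_ge0. Qed.

Lemma opt_mono C y y' : nonneg_vec y -> (forall r, y 0 r <= y' 0 r) ->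
  opt X C y <= opt X C y'.
Proof.
move=> hy hyy; apply: le_opt => x hx; apply: le_trans (opt_le hy hx) _.
by apply: ler_sum => r _; rewrite ler_wpM2r // (X_ge0 hx).
Qed.

Lemma opt_scale C y (c : R) : 0 < c -> nonneg_vec y ->
  opt X C (c *: y) = c * opt X C y.
Proof.
move=> c0 hy.
have dE u (k : R) x : dotr (k *: u) x = k * dotr u x.
  by rewrite /dotr mulr_sumr; apply: eq_bigr => r _; rewrite mxE mulrA.
have hcy : nonneg_vec (c *: y) by move=> r; rewrite mxE mulr_ge0 // ltW.
apply/eqP; rewrite eq_le; apply/andP; split.
  rewrite -ler_pdivrMl //; apply: le_opt => x hx.
  by rewrite ler_pdivrMl // -dE; exact: opt_le.
by apply: le_opt => x hx; rewrite dE ler_pM2l //; exact: opt_le.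
Qed.

Lemma mink_ge0 x : minkowski_sum X x -> nonneg_vec x.
Proof.
by move=> [g hg ->] r; rewrite summxE; apply: sumr_ge0 => C _; exact: X_ge0 (hg C) r.
Qed.

Lemma mink_nonempty : minkowski_sum X !=set0.
Proof.
have h C : exists x, X C x by have [[x hx] _ _ _] := hX C; exists x.
have [g hg] := choice h.
by exists (\sum_C g C), g.
Qed.

Lemma lambda_le x : minkowski_sum X x -> lambda_star X <= `|x|.
Proof.
by move=> hx; apply: ge_inf; [exists 0 => _ [u _ <-]|exists x].
Qed.

Lemma le_lambda (e : R) :
  (forall x, minkowski_sum X x -> e <= `|x|) -> e <= lambda_star X.
Proof.
move=> h; apply: lb_le_inf; last by move=> _ [x hx <-]; exact: h.
by have [x hx] := mink_nonempty; exists `|x|, x.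
Qed.

Lemma lambda_ge0 : 0 <= lambda_star X.
Proof. exact: le_lambda. Qed.

Lemma lambda_le_coord x (e : R) : minkowski_sum X x -> 0 <= e ->
  (forall r, x 0 r <= e) -> lambda_star X <= e.
Proof.
move=> hx e0 h; apply: le_trans (lambda_le hx) _; apply: norm_le_coord => // r.
by rewrite ger0_norm // (mink_ge0 hx).
Qed.

Lemma dotr_suml y (g : 'I_n -> 'rV[R]_m) :
  dotr y (\sum_C g C) = \sum_C dotr y (g C).
Proof.
rewrite /dotr exchange_big /=; apply: eq_bigr => r _.
by rewrite summxE mulr_sumr.
Qed.

(** Weak duality: every [x] in the Minkowski sum costs at least the sum of the block optima and at
    most [|x|] times the sum of the prices; a positive price allows division by that sum. *)
Lemma sum_opt_le y : nonneg_vec y -> (exists r, 0 < y 0 r) ->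
  \sum_C opt X C y <= lambda_star X * \sum_r y 0 r.
Proof.
move=> hy [r0 hr0].
have Y0 : 0 < \sum_r y 0 r.
  by rewrite (bigD1 r0) //= ltr_pwDl // sumr_ge0.
rewrite -ler_pdivrMr //; apply: le_lambda => x hx.
rewrite ler_pdivrMr //; case: (hx) => g hg xE.
apply: (@le_trans _ _ (dotr y x)).
  by rewrite xE dotr_suml; apply: ler_sum => C _; exact: opt_le.
rewrite /dotr mulr_sumr; apply: ler_sum => r _.
rewrite mulrC ler_wpM2r //; apply: le_trans (norm_ge_coord x r).
exact: ler_norm.
Qed.

Lemma sum_opt_le_min_dot z : nonneg_vec z ->
  \sum_C opt X C z <= min_dot (minkowski_sum X) z.
Proof.
move=> hz; apply: lb_le_inf.
  by have [x hx] := mink_nonempty; exists (dotr z x), x.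
move=> _ [x [g hg ->] <-]; rewrite dotr_suml.
by apply: ler_sum => C _; exact: opt_le.
Qed.

Lemma bigmax_C_ge (y : 'I_n -> 'rV[R]_m) (r : 'I_m) C :
  y C 0 r <= \big[Num.max/0]_D y D 0 r.
Proof. exact: (le_bigmax _ (fun D => y D 0 r) C). Qed.

(** All customers are compared at the coordinatewise maximum [u] of their prices: by monotonicity of
    [opt], the answer to [y C] costs at most [sigma * opt X C u], and weak duality at [u]
    concludes. *)
Lemma weak_duality_setT : local_weak_duality f [set: 'I_m]%SET (sigma * lambda_star X).
Proof.
move=> y hy; pose u : 'rV[R]_m := \row_r \big[Num.max/0]_C y C 0 r.
have hu : nonneg_vec u.
  by move=> r; rewrite mxE; exact: bigmax_ge_id.
have setTE (F : 'I_m -> R) : \sum_(r in [set: 'I_m]%SET) F r = \sum_r F r.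
  by apply: eq_bigl => r; rewrite inE.
have val_le C : \sum_(r in [set: 'I_m]%SET) y C 0 r * f C (y C) 0 r <= sigma * opt X C u.
  rewrite setTE; have [_ h] := hf C (hy C); apply: le_trans h _.
  rewrite ler_wpM2l ?(le_trans ler01) //; apply: opt_mono => // r.
  by rewrite mxE bigmax_C_ge.
apply: le_trans (ler_sum _ (fun C _ => val_le C)) _.
rewrite -mulr_sumr -mulrA ler_wpM2l ?(le_trans ler01) // setTE.
rewrite [X in _ * X](eq_bigr (fun r => u 0 r)); last by move=> r _; rewrite mxE.
case: (pselect (exists r, 0 < u 0 r)) => [/(sum_opt_le hu) //|nu].
(* At [u = 0] weak duality cannot be normalised, but there all block optima are 0. *)
have u0 r : u 0 r = 0.
  apply/eqP; rewrite eq_le hu andbT leNgt; apply/negP => h; apply: nu; by exists r.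
rewrite [in leRHS]big1 ?mulr0 => [|r _]; last by rewrite u0.
rewrite big1 // => C _.
apply/eqP; rewrite eq_le opt_ge0 // andbT.
have [[x hx] _ _ _] := hX C; apply: le_trans (opt_le hu hx) _.
by rewrite /dotr big1 // => r _; rewrite u0 mul0r.
Qed.

Definition scaled A (c : R) x := exists2 p, A p & x = c *: p.

Lemma scaled0 C : scaled (X C) 0 0.
Proof. by have [[p hp] _ _ _] := hX C; exists p => //; rewrite scale0r. Qed.

(** Convexity with the weights [a / (a + c)] and [c / (a + c)]. *)
Lemma scaledD C (a c : R) x b : 0 <= a -> 0 < c -> scaled (X C) a x -> X C b ->
  scaled (X C) (a + c) (x + c *: b).
Proof.
move=> a0 c0 [p hp ->] hb.
have ac : 0 < a + c by lra.
have [_ _ hc _] := hX C.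
have hl : 0 <= a / (a + c) <= 1.
  rewrite divr_ge0 //=; last lra.
  by rewrite ler_pdivrMr // mul1r lerDl ltW.
have [l0 l1] := andP hl.
pose i := Itv01 l0 l1.
exists ((a / (a + c)) *: p + (c / (a + c)) *: b).
  have := hc p b i (mem_set hp) (mem_set hb); rewrite inE /conv /= /unstable.onem.
  suff -> : 1 - a / (a + c) = c / (a + c) by [].
  by field; rewrite gt_eqF.
rewrite scalerDr !scalerA !mulrA ![(a + c) * _]mulrC.
by rewrite ![_ * (a + c) / _]mulfK // gt_eqF.
Qed.
End Geometry.

(** * A single phase *)

Section Phase.
Variables (R : realType) (n m : nat).
Variables (X : 'I_n -> set 'rV[R]_m) (f : 'I_n -> 'rV[R]_m -> 'rV[R]_m).
Variable sigma : R.
Hypothesis hX : rs_instance X.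
Hypothesis hf : block_solver sigma X f.
Hypothesis hsigma : 1 <= sigma.
Variable e : R.
Hypothesis e0 : 0 < e.
Implicit Types (x y z b : 'rV[R]_m) (A : set 'rV[R]_m) (S : {set 'I_m}).

(** The weight that customer [D] has received so far in the phase: customers are served in order,
    [C] is the current one and is still owed [rem]. *)
Definition spent (w rem : R) (C : nat) (D : 'I_n) : R :=
  if (D < C)%N then w else if D == C :> nat then w - rem else 0.

Definition price S (D : 'I_n) (u : 'rV[R]_m) : R :=
  \sum_(r in S) u 0 r * f D u 0 r.

Definition bump_prices (xi : R) b y : 'rV[R]_m :=
  \row_r (y 0 r * (1 + e * (xi * b 0 r))).

(* [ys] are the prices at the start of the phase, [Gs D] and [G D] the amounts
   that count for customer [D] at the start of the phase and now, and [J] is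
   the load left over from aborted phases. *)
Record phase_inv (w W : R) (ys : 'rV[R]_m) (Gs : 'I_n -> 'rV[R]_m)
    (J : 'rV[R]_m) (C : nat) (rem : R) (y x : 'rV[R]_m)
    (G : 'I_n -> 'rV[R]_m) : Prop := PhaseInv {
  ph_C : (C <= n)%N;
  ph_rem : 0 < rem <= w;
  ph_ys : forall r, 1 <= ys 0 r <= y 0 r;
  ph_x0 : nonneg_vec x;
  ph_exp : forall r, expR (e / (1 + e) * x 0 r) <= y 0 r;
  ph_growth : forall S, exists2 u : 'I_n -> 'rV[R]_m,
    forall D, nonneg_vec (u D) /\ (forall r, u D 0 r <= y 0 r) &
    \sum_(r in S) y 0 r - \sum_(r in S) ys 0 r
      <= e * \sum_D spent w rem C D * price S D (u D);
  ph_G : forall D, scaled (X D) (W + spent w rem C D) (G D);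
  ph_GsG : forall D r, Gs D 0 r <= G D 0 r;
  ph_xE : x = J + \sum_D G D }.

Lemma spent_ge0 w rem C D : 0 < rem <= w -> 0 <= spent w rem C D <= w.
Proof. by move=> h; rewrite /spent; case: ifP => _; [|case: ifP => _]; lra. Qed.

Lemma spent0 w D : spent w w 0 D = 0.
Proof. by rewrite /spent ltn0; case: ifP => // _; rewrite subrr. Qed.

Lemma spentn w rem D : spent w rem n D = w.
Proof. by rewrite /spent ltn_ord. Qed.

(** The two outcomes of a step: [C] stays current and is owed less, or [C] is finished and its
    successor starts with the full weight [w]. *)
Lemma spent_next w rem xi (C : 'I_n) (C' : nat) (rem' : R) :
  (C' = C /\ rem' = rem - xi) \/ [/\ C' = C.+1, rem' = w & xi = rem] ->
  forall D, spent w rem' C' D = spent w rem C D + (if D == C then xi else 0).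
Proof.
move=> h D; rewrite /spent -val_eqE /=.
case: h => [[-> ->]|[-> -> ->]].
  case: ltngtP => // _; ring.
case: (ltngtP D C) => h.
- by rewrite ltnS (ltnW h) addr0.
- by rewrite ltnS leqNgt h /=; case: eqP; rewrite ?subrr ?addr0.
- by rewrite h ltnSn subrK.
Qed.

Lemma phase_start w W y x J G : 0 < w ->
  (forall r, 1 <= y 0 r) -> nonneg_vec x ->
  (forall r, expR (e / (1 + e) * x 0 r) <= y 0 r) ->
  (forall D, scaled (X D) W (G D)) -> x = J + \sum_D G D ->
  phase_inv w W y G J 0 w y x G.
Proof.
move=> w0 hy hx hexp hG xE; split=> //; first by lra.
- by move=> r; rewrite hy lexx.
- move=> S; exists (fun=> 0) => [D|]; first split=> r; rewrite ?mxE //.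
    by apply: le_trans (hy r).
  by rewrite subrr big1 ?mulr0 // => D _; rewrite spent0 mul0r.
- by move=> D; rewrite spent0 addr0.
Qed.

Lemma price_ge0 S D u : nonneg_vec u -> 0 <= price S D u.
Proof.
move=> hu; apply: sumr_ge0 => r _; rewrite mulr_ge0 //.
by have [h _] := hf D hu; exact: (X_ge0 hX h).
Qed.

(** * Effect of one oracle answer within a phase *)

Section Step.
Variables (w W : R) (ys : 'rV[R]_m) (Gs : 'I_n -> 'rV[R]_m) (J : 'rV[R]_m).
Variables (C : 'I_n) (rem : R) (y x : 'rV[R]_m) (G : 'I_n -> 'rV[R]_m).
Hypothesis W0 : 0 <= W.
Hypothesis hph : phase_inv w W ys Gs J C rem y x G.

Lemma phase_y_ge0 : nonneg_vec y.
Proof. by move=> r; have := ph_ys hph r; lra. Qed.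

Let b := f C y.

Lemma answer_in : X C b.
Proof. by have [] := hf C phase_y_ge0. Qed.

Lemma answer_ge0 : nonneg_vec b.
Proof. exact: (X_ge0 hX answer_in). Qed.

Variables (xi : R) (C' : nat) (rem' : R).
Hypothesis xi0 : 0 < xi.
Hypothesis xib : forall r, xi * b 0 r <= 1.
Hypothesis hnext : [/\ C' = C, rem' = rem - xi & 0 < rem'] \/
  [/\ C' = C.+1, rem' = w & xi = rem].

Let y' := bump_prices xi b y.
Let x' : 'rV[R]_m := \row_r (x 0 r + xi * b 0 r).

Lemma xib_ge0 r : 0 <= xi * b 0 r.
Proof. by rewrite mulr_ge0 ?answer_ge0 // ltW. Qed.

Lemma bump_ge r : y 0 r <= y' 0 r.
Proof.
rewrite mxE mulrDr mulr1 lerDl mulr_ge0 ?phase_y_ge0 // mulr_ge0 ?xib_ge0 //.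
exact: ltW.
Qed.

Lemma sum_bump S :
  \sum_(r in S) y' 0 r = \sum_(r in S) y 0 r + e * (xi * price S C y).
Proof.
rewrite /price !mulr_sumr -big_split /=; apply: eq_bigr => r _.
by rewrite mxE -/b; ring.
Qed.

(** Since [xi * b 0 r <= 1]. This caps how far the single step that triggers an abort can
    overshoot. *)
Lemma sum_bump_le : \sum_r y' 0 r <= (1 + e) * \sum_r y 0 r.
Proof.
rewrite mulr_sumr; apply: ler_sum => r _; rewrite mxE mulrC.
rewrite ler_wpM2r ?phase_y_ge0 // lerD2l -[leRHS]mulr1 ler_wpM2l //.
exact: ltW.
Qed.

Lemma phase_step :
  phase_inv w W ys Gs J C' rem' y' x' (fun D => if D == C then G D + xi *: b else G D).
Proof.
have hn : (C' = C /\ rem' = rem - xi) \/ [/\ C' = C.+1, rem' = w & xi = rem].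
  by case: hnext => [[]|]; [left|right].
have sE := spent_next hn.
have hrem := ph_rem hph.
have hs D := spent_ge0 C D hrem.
split.
- by case: hnext => [[-> _ _]|[-> _ _]]; rewrite ?ltn_ord // ltnW.
- have /andP[r1 r2] := hrem; move: xi0.
  case: hnext => [[_ -> h]|[_ -> _]] ?; apply/andP; split; lra.
- move=> r; have /andP[-> h] := ph_ys hph r.
  exact: le_trans h (bump_ge r).
- by move=> r; rewrite mxE addr_ge0 ?xib_ge0 // (ph_x0 hph).
(* Loads add while prices multiply; [expR_le_1Dmul] compares the two for one step. *)
- move=> r; rewrite !mxE mulrDr expRD ler_pM ?expR_ge0 //.
    exact: ph_exp hph r.
  by apply: expR_le_1Dmul => //; rewrite xib_ge0 xib.
(* Local weak duality admits only one price vector per customer, so of all queries of [C] in this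
   phase the one of largest [price S] is retained as the witness; it depends on [S]. *)
- move=> S; have [u hu hg] := ph_growth hph S.
  exists (fun D => if (D == C) && (price S C (u C) < price S C y) then y else u D).
    move=> D; case: ifP => _; first by split; [exact: phase_y_ge0|exact: bump_ge].
    have [h1 h2] := hu D; split=> // r; exact: le_trans (h2 r) (bump_ge r).
  rewrite sum_bump addrAC.
  apply: (@le_trans _ _ (e * \sum_D spent w rem C D * price S D (u D)
                         + e * (xi * price S C y))); first by rewrite lerD2r.
  rewrite -mulrDr ler_pM2l // [in leRHS](bigD1 C) //= [in leLHS](bigD1 C) //=.
  rewrite eqxx /= sE eqxx.
  rewrite [X in _ <= _ + X](eq_bigr (fun D => spent w rem C D * price S D (u D))).
    rewrite addrAC lerD2r.
    move: xi0 => ?; have /andP[? _] := hs C.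
    by case: (ltP (price S C (u C)) (price S C y)) => ?; nra.
  by move=> D /negbTE DC; rewrite sE DC /= addr0.
- move=> D; rewrite sE; have hG := ph_G hph D; case: eqP => [E|_]; last by rewrite addr0.
  subst D; rewrite addrA; apply: (scaledD hX _ xi0 hG answer_in).
  by rewrite addr_ge0 //; have := hs C; lra.
- move=> D r; apply: le_trans (ph_GsG hph D r) _; case: eqP => // _.
  by rewrite !mxE lerDl xib_ge0.
- have -> : x' = x + xi *: b by apply/rowP => r; rewrite !mxE.
  rewrite (ph_xE hph) -addrA; congr (_ + _).
  rewrite (bigD1 C) //= [in RHS](bigD1 C) //= eqxx.
  rewrite addrAC; congr (_ + _); apply: eq_bigr => D /negbTE ->; by [].
Qed.

Lemma sum_load_mono : \sum_r x 0 r <= \sum_r x' 0 r.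
Proof. by apply: ler_sum => r _; rewrite mxE lerDl xib_ge0. Qed.

(** Pays for a call that leaves its customer unfinished. *)
Lemma sum_load_incr r0 : xi * b 0 r0 = 1 -> \sum_r x 0 r + 1 <= \sum_r x' 0 r.
Proof.
move=> h; rewrite (bigD1 r0) //= [in leRHS](bigD1 r0) //= mxE h addrAC lerD2l.
by apply: ler_sum => r _; rewrite mxE lerDl xib_ge0.
Qed.

End Step.

(** * Growth of the prices over a phase *)

Section Growth.
Variables (w W : R) (ys : 'rV[R]_m) (Gs : 'I_n -> 'rV[R]_m) (J : 'rV[R]_m).
Variables (C : nat) (rem : R) (y x : 'rV[R]_m) (G : 'I_n -> 'rV[R]_m).
Hypothesis hph : phase_inv w W ys Gs J C rem y x G.

Let yge0 : nonneg_vec y.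
Proof. by move=> r; have := ph_ys hph r; lra. Qed.

Let w0 : 0 < w. Proof. by have := ph_rem hph; lra. Qed.

Lemma phase_growth S : exists2 u : 'I_n -> 'rV[R]_m,
    forall D, nonneg_vec (u D) /\ (forall r, u D 0 r <= y 0 r) &
    \sum_(r in S) y 0 r - \sum_(r in S) ys 0 r <= e * w * \sum_D price S D (u D).
Proof.
have [u hu hg] := ph_growth hph S; exists u => //; apply: le_trans hg _.
rewrite -mulrA ler_pM2l // mulr_sumr; apply: ler_sum => D _.
apply: ler_wpM2r; first by apply: price_ge0; case: (hu D).
by have := spent_ge0 C D (ph_rem hph); lra.
Qed.

(** The witnesses [u D] are at most the current prices [y], hence so is their maximum over
    customers. The bound thus refers to the prices at the end, which yields the growth factor
    [1 / (1 - e * w * mu)]. *)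
Lemma phase_growth_lwd S mu : 0 <= mu -> local_weak_duality f S mu ->
  \sum_(r in S) y 0 r - \sum_(r in S) ys 0 r <= e * w * mu * \sum_(r in S) y 0 r.
Proof.
move=> mu0 hS; have [u hu hg] := phase_growth S; apply: le_trans hg _.
rewrite -[leRHS]mulrA ler_wpM2l //; first by rewrite mulr_ge0 // ltW.
apply: le_trans (hS u (fun D => (hu D).1)) _; rewrite ler_wpM2l //.
apply: ler_sum => r _; apply/bigmax_leP; split=> // D _; exact: (hu D).2.
Qed.

(** By monotonicity of [opt], block optima at earlier prices are at most those at [y]. This is why
    the prices after a phase of large growth form a good dual solution. *)
Lemma phase_growth_opt :
  \sum_r y 0 r - \sum_r ys 0 r <= e * w * sigma * \sum_D opt X D y.
Proof.
have [u hu hg] := phase_growth [set: 'I_m]%SET.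
have setTE (F : 'I_m -> R) : \sum_(r in [set: 'I_m]%SET) F r = \sum_r F r.
  by apply: eq_bigl => r; rewrite inE.
rewrite !setTE in hg; apply: le_trans hg _.
rewrite -[leRHS]mulrA ler_wpM2l //; first by rewrite mulr_ge0 // ltW.
rewrite mulr_sumr; apply: ler_sum => D _; rewrite /price setTE.
have [h1 h2] := hu D; have [_ h] := hf D h1; apply: le_trans h _.
rewrite ler_wpM2l //; first by apply: le_trans hsigma.
exact: opt_mono.
Qed.

End Growth.
End Phase.

(** * A sequence of phases *)

Section Stage.
Variables (R : realType) (n m : nat).
Variables (X : 'I_n -> set 'rV[R]_m) (f : 'I_n -> 'rV[R]_m -> 'rV[R]_m).
Variable sigma : R.
Hypothesis hX : rs_instance X.
Hypothesis hf : block_solver sigma X f.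
Hypothesis hsigma : 1 <= sigma.
Hypothesis m0 : (0 < m)%N.
Hypothesis n0 : (0 < n)%N.
Variables e Phi w0 : R.
Hypothesis e01 : 0 < e <= 1.
Hypothesis w00 : 0 < w0.
Implicit Types (x y z b : 'rV[R]_m) (S : {set 'I_m}).

Let lam := lambda_star X.

Let e0 : 0 < e. Proof. by case/andP: e01. Qed.

(* [N] phases have been completed and [A] have been aborted. *)
Record stage_inv_at (N A : nat) (ys : 'rV[R]_m) (Gs G : 'I_n -> 'rV[R]_m)
    (J : 'rV[R]_m) (j C : nat) (rem w W Y0 best : R) (y x z : 'rV[R]_m) : Prop :=
  StageInv {
  si_ph : phase_inv X f e w W ys Gs J C rem y x G;
  si_C : (C < n)%N;
  si_W : N%:R * w <= W;
  si_N : N%:R <= Phi + 1;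
  si_w : w = w0 / 2 ^+ A;
  si_Gs : forall D, scaled (X D) W (Gs D);
  si_J : nonneg_vec J /\ (A = 0%N -> J = 0);
  si_Y0 : Y0 = \sum_r ys 0 r;
  si_Y : \sum_r y 0 r <= (1 + e) * Y0;
  si_Y0_le : Y0 <= m%:R * expR (2 * e * (N + A)%:R);
  si_A : (0 < A)%N -> 2 ^+ A < 4 * sigma * lam * w0;
  si_j : j%:R <= (n * (N + A) + C)%:R + \sum_r x 0 r;
  si_exact : A = 0%N -> W = N%:R * w;
  si_lwd : A = 0%N -> forall S mu, 0 <= mu -> local_weak_duality f S mu ->
    e * w0 * mu < 1 ->
    \sum_(r in S) ys 0 r
      <= m%:R * expR (N%:R * (e * w0 * mu / (1 - e * w0 * mu)));
  si_best : A = 0%N -> [/\ 0 <= best, N = 0%N -> best = 0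
    & Y0 <= m%:R * best ^+ N];
  si_z : A = 0%N -> (0 < N)%N -> [/\ simplex z, 0 < best
    & 1 - best^-1 <= e * w0 * sigma * \sum_D opt X D z];
  si_stop : W < Phi * w \/ [/\ C = 0%N, rem = w & y = ys] }.

Definition stage_inv j C rem w W Y0 best y x z :=
  exists N A ys Gs G J, stage_inv_at N A ys Gs G J j C rem w W Y0 best y x z.

Lemma sum_row1 : \sum_(r < m) (const_mx 1 : 'rV[R]_m) 0 r = m%:R.
Proof.
rewrite (eq_bigr (fun=> 1)) => [|r _]; last by rewrite mxE.
by rewrite sumr_const card_ord.
Qed.

Lemma stage_init z : 0 <= Phi ->
  stage_inv 0 0 w0 w0 0 m%:R 0 (const_mx 1) 0 z.
Proof.
move=> Phi0.
exists 0%N, 0%N, (const_mx 1), (fun=> 0), (fun=> 0), 0.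
split=> //.
- apply: phase_start => //.
  + by move=> r; rewrite mxE.
  + by move=> r; rewrite mxE.
  + by move=> r; rewrite !mxE mulr0 expR0.
  + by move=> D; exact: scaled0 hX D.
  + by rewrite big1 ?addr0.
- by rewrite mul0r.
- by rewrite addr_ge0.
- by rewrite expr0 divr1.
- by move=> D; exact: scaled0 hX D.
- by split=> // r; rewrite mxE.
- by rewrite sum_row1.
- rewrite sum_row1 mulrDl mul1r lerDl mulr_ge0 // ltW //; by case/andP: e01.
- by rewrite mulr0 expR0 mulr1.
- by rewrite muln0 addn0 add0r sumr_ge0 // => r _; rewrite mxE.
- by rewrite mul0r.
- move=> _ S mu mu0 hS h; rewrite mul0r expR0 mulr1 -sum_row1.
  rewrite [leRHS](bigID (mem S)) /= lerDl sumr_ge0 // => r _; by rewrite mxE.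
- by rewrite expr0 mulr1.
- by right.
Qed.

(** * One oracle call in a sequence of phases: abort, continue or complete *)

Section Step.
Variables (j : nat) (C : 'I_n) (rem w W Y0 best : R) (y x z : 'rV[R]_m).
Variables (N A : nat) (ys : 'rV[R]_m) (Gs G : 'I_n -> 'rV[R]_m) (J : 'rV[R]_m).
Hypothesis hst : stage_inv_at N A ys Gs G J j C rem w W Y0 best y x z.
Hypothesis hrun : W < Phi * w.

Let hph := si_ph hst.
Let w_gt0 : 0 < w. Proof. by have := ph_rem hph; lra. Qed.
Let W_ge0 : 0 <= W.
Proof. by apply: le_trans (si_W hst); rewrite mulr_ge0 // ltW. Qed.
Let N_lt : N%:R < Phi.
Proof.
rewrite -(ltr_pM2r w_gt0); apply: le_lt_trans (si_W hst) _; exact: hrun.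
Qed.

Let b := f C y.
Variables (xi : R) (C' : nat) (rem' : R).
Hypothesis xi0 : 0 < xi.
Hypothesis xib : forall r, xi * b 0 r <= 1.
Hypothesis hnext :
  [/\ C' = C, rem' = rem - xi, 0 < rem' & exists r, xi * b 0 r = 1] \/
  [/\ C' = C.+1, rem' = w & xi = rem].

Let y' := bump_prices e xi b y.
Let x' : 'rV[R]_m := \row_r (x 0 r + xi * b 0 r).
Let Y' := \sum_r y' 0 r.
Let G' D := if D == C then G D + xi *: b else G D.

Let hph' : phase_inv X f e w W ys Gs J C' rem' y' x' G'.
Proof.
apply: (phase_step hX hf e0 W_ge0 hph xi0 xib).
by case: hnext => [[? ? ? _]|[? ? ?]]; [left|right].
Qed.

Let y'_ge1 r : 1 <= y' 0 r.
Proof. by have := ph_ys hph' r; lra. Qed.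

Let Y'_gt0 : 0 < Y'.
Proof.
rewrite /Y' (bigD1 (Ordinal m0)) //= ltr_pwDl //.
  exact: lt_le_trans (y'_ge1 _).
by rewrite sumr_ge0 // => r _; apply: le_trans (y'_ge1 r).
Qed.

Let Y0_gt0 : 0 < Y0.
Proof.
have h r : 1 <= ys 0 r by have := ph_ys hph r; lra.
rewrite (si_Y0 hst) (bigD1 (Ordinal m0)) //= ltr_pwDl //.
  exact: lt_le_trans (h _).
by rewrite sumr_ge0 // => r _; apply: le_trans (h r).
Qed.

Let Y'_le : Y' <= (1 + e) * ((1 + e) * Y0).
Proof.
apply: le_trans (sum_bump_le e0 hph xib) _.
by rewrite ler_pM2l ?(si_Y hst) // addr_gt0.
Qed.

(** Before its last step a phase has grown the sum by at most [1 + e], and the last step adds at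
    most another such factor; so each phase, completed or aborted, costs at most [expR (2 * e)]. *)
Let Y'_le_exp : Y' <= m%:R * expR (2 * e * (N + A).+1%:R).
Proof.
apply: le_trans Y'_le _.
have h1 : 1 + e <= expR e := expR_ge1Dx e.
have p1 : 0 <= 1 + e by rewrite addr_ge0 // ltW.
rewrite mulrA mulrC -[(N + A).+1%:R]natr1 (mulrDr (2 * e)) mulr1 expRD mulrA.
rewrite ler_pM ?(si_Y0_le hst) ?mulr_ge0 ?(ltW Y0_gt0) //.
have -> : 2 * e = e + e by ring.
by rewrite expRD ler_pM.
Qed.

(** Each call is charged either to a finished customer or to a unit of load. *)
Let count_step : j.+1%:R <= (n * (N + A) + C')%:R + \sum_r x' 0 r.
Proof.
have hj := si_j hst; rewrite -natr1.
case: hnext => [[-> _ _ [r hr]]|[-> _ _]].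
  have := sum_load_incr hX hf hph xi0 hr; rewrite -/x' => h.
  by apply: le_trans (lerD hj (lexx 1)) _; rewrite -addrA lerD2l.
rewrite addnS -natr1 addrAC; apply: lerD => //; apply: le_trans hj _.
by rewrite lerD2l; exact: (sum_load_mono hX hf hph xi0).
Qed.

Lemma stage_abort : (1 + e) * Y0 < Y' ->
  stage_inv j.+1 0 (w / 2) (w / 2) W Y' best y' x' z.
Proof.
(* The load of the aborted phase is kept but no longer counted: it moves into [J], and the counted
   amounts return to [Gs]. [W] is unchanged, and [N] times the halved weight is still at most
   [W]. *)
move=> hab; exists N, A.+1, y', Gs, Gs, (x' - \sum_D Gs D).
have Gs_le r : (\sum_D Gs D) 0 r <= x' 0 r.
  rewrite (ph_xE hph') mxE; apply: ler_wpDl; first exact: (si_J hst).1.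
  by rewrite !summxE; apply: ler_sum => D _; exact: ph_GsG hph' D r.
have w2 : 0 < w / 2 by rewrite divr_gt0.
split=> //.
- apply: phase_start => //.
  + exact: ph_x0 hph'.
  + exact: ph_exp hph'.
  + exact: si_Gs hst.
  + by rewrite subrK.
- apply: le_trans (si_W hst); rewrite ler_wpM2l //; lra.
- exact: si_N hst.
- by rewrite (si_w hst) exprSr invfM mulrA.
- exact: si_Gs hst.
- by split=> // r; rewrite [X in 0 <= X]mxE [X in _ <= _ + X]mxE subr_ge0.
- by rewrite mulrDl mul1r lerDl mulr_ge0 // ltW.
- by rewrite addnS.
- move=> _.
  have lam0 : 0 <= sigma * lam by rewrite mulr_ge0 ?(lambda_ge0 hX) //; apply: le_trans hsigma.
  have := phase_growth_lwd hX hf e0 hph' lam0 (weak_duality_setT hX hf hsigma).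
  have setTE (F : 'I_m -> R) : \sum_(r in [set: 'I_m]%SET) F r = \sum_r F r.
    by apply: eq_bigl => r; rewrite inE.
  rewrite !setTE -(si_Y0 hst) -/Y'.
  set k := w * (sigma * lam) => h.
  have k0 : 0 <= k by rewrite mulr_ge0 // ltW.
  (* The abort certifies that [w] is too large: growth above [1 + e] against
     [Y' * (1 - e * k) <= Y0] gives [(1 + e) * (1 - e * k) < 1], hence [k * (1 + e) > 1], and
     [e <= 1]. *)
  have hk : 1 < 2 * k.
    have h1 : Y' * (1 - e * k) <= Y0.
      by move: h; rewrite -[e * w * _]mulrA -/k; lra.
    have h2 : (1 + e) * (Y' * (1 - e * k)) < Y' * 1.
      apply: le_lt_trans (_ : (1 + e) * Y0 < _); last by rewrite mulr1.
      by rewrite ler_pM2l // addr_gt0.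
    have h3 : (1 + e) * (1 - e * k) < 1 by rewrite -(ltr_pM2l Y'_gt0); lra.
    have [/andP[_ e1] e00] := (e01, e0).
    have h4 : 0 < e * (k * (1 + e) - 1) by lra.
    have h5 : 0 < k * (1 + e) - 1 by rewrite -(pmulr_rgt0 _ e0).
    nra.
  have p2 : 0 < 2 ^+ A :> R by rewrite exprn_gt0.
  have wE : w * 2 ^+ A = w0 by rewrite (si_w hst) divfK // gt_eqF.
  rewrite exprS -wE.
  have -> : 4 * sigma * lam * (w * 2 ^+ A) = 2 * (2 * k) * 2 ^+ A by rewrite /k; ring.
  by rewrite ltr_pM2r //; lra.
- apply: le_trans count_step _; rewrite lerD2r ler_nat addn0 addnS mulnS.
  by rewrite addnC leq_add2r; exact: ph_C hph'.
- by right.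
Qed.

Lemma stage_continue : Y' <= (1 + e) * Y0 -> (C' < n)%N ->
  stage_inv j.+1 C' rem' w W Y0 best y' x' z.
Proof.
move=> hY hC; exists N, A, ys, Gs, G', J.
case: hst => *; split=> //; by left.
Qed.

Lemma stage_complete : Y' <= (1 + e) * Y0 -> (n <= C')%N ->
  stage_inv j.+1 0 w w (W + w) Y'
    (if best * Y0 < Y' then Y' / Y0 else best) y' x'
    (if best * Y0 < Y' then \row_r (y' 0 r / Y') else z).
Proof.
move=> hY hC; exists N.+1, A, y', G', G', J.
have C'n : C' = n by apply/eqP; rewrite eqn_leq hC (ph_C hph').
have hG D : scaled (X D) (W + w) (G' D).
  by have := ph_G hph' D; rewrite C'n spentn.
have y'0 : nonneg_vec y' by move=> r; apply: le_trans (y'_ge1 r).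
split=> //.
- apply: phase_start => //.
  + exact: ph_x0 hph'.
  + exact: ph_exp hph'.
  + exact: ph_xE hph'.
- by rewrite -natr1 mulrDl mul1r lerD2r (si_W hst).
- by rewrite -natr1 lerD2r ltW.
- exact: si_w hst.
- exact: si_J hst.
- by rewrite mulrDl mul1r lerDl mulr_ge0 // ltW.
- exact: si_A hst.
- apply: le_trans count_step _; rewrite lerD2r ler_nat addn0 C'n addSn mulnS.
  by rewrite addnC.
- by move=> /(si_exact hst) ->; rewrite -natr1 mulrDl mul1r.
- move=> A0 S mu mu0 hS ht.
  have wE : w = w0 by rewrite (si_w hst) A0 expr0 divr1.
  have := phase_growth_lwd hX hf e0 hph' mu0 hS; rewrite wE.
  have := si_lwd hst A0 mu0 hS ht.
  set t := e * w0 * mu in ht *; set a := \sum_(r in S) y' 0 r.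
  set c := \sum_(r in S) _ => h1 h2.
  have t1 : 0 < 1 - t by lra.
  (* One more completed phase contributes the factor [1 / (1 - t)]. *)
  have h3 : a <= c / (1 - t) by rewrite ler_pdivlMr //; lra.
  apply: le_trans h3 _.
  rewrite -natr1 mulrDl mul1r expRD mulrA ler_pM ?invr_ge0 ?(ltW t1) //.
    by apply: sumr_ge0 => r _; have := ph_ys hph r; lra.
  exact: expR_ge_invB.
- move=> A0; have [b0 _ hb] := si_best hst A0.
  have hle : best <= (if best * Y0 < Y' then Y' / Y0 else best).
    by case: ifP => // /ltW h; rewrite ler_pdivlMr.
  split=> //; first exact: le_trans hle.
  rewrite exprS mulrCA.
  apply: (@le_trans _ _ ((if best * Y0 < Y' then Y' / Y0 else best) * Y0)).
    by case: ltP => // _; rewrite divfK // gt_eqF.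
  rewrite ler_wpM2l ?(le_trans b0) //; apply: le_trans hb _.
  by rewrite ler_wpM2l // lerXn2r // nnegrE (le_trans b0).
- move=> A0 _; have [b0 bN hb] := si_best hst A0.
  case: ltP => hlt; last first.
    (* Since [best] starts at 0, the first completed phase always records its prices; a phase that
       does not is therefore not the first. *)
    apply: (si_z hst A0); rewrite lt0n; apply/eqP => /bN b00.
    by move: hlt Y'_gt0; rewrite b00 mul0r; lra.
  have zE : \row_r (y' 0 r / Y') = Y'^-1 *: y'.
    by apply/rowP => r; rewrite !mxE mulrC.
  split.
  + have z0 r : 0 <= (\row_r (y' 0 r / Y')) 0 r.
      by rewrite mxE divr_ge0 ?y'0 // ltW.
    have s1 : \sum_r (\row_r (y' 0 r / Y')) 0 r = 1.
      rewrite (eq_bigr (fun r => y' 0 r / Y')) => [|r _]; last by rewrite mxE.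
      by rewrite -mulr_suml divff // gt_eqF.
    split=> [r|].
      rewrite z0 /= -s1 (bigD1 r) //= lerDl; apply: sumr_ge0 => i _; exact: z0.
    by rewrite -[RHS]s1; apply: eq_bigr => r _; rewrite ger0_norm.
  + by rewrite divr_gt0.
  + have wE : w = w0 by rewrite (si_w hst) A0 expr0 divr1.
    (* Division by [Y'] normalises the prices to [z] and turns the growth into [1 - Y0 / Y'], the
       inverse of the new [best]. *)
    have := phase_growth_opt hX hf hsigma e0 hph'.
    rewrite wE -(si_Y0 hst) -/Y' => h.
    rewrite zE (eq_bigr (fun D => Y'^-1 * opt X D y')) => [|D _]; last first.
      by rewrite (opt_scale hX) // invr_gt0.
    rewrite -mulr_sumr mulrCA -[leRHS]mulrC ler_pdivlMr // invf_div.
    by rewrite mulrBl mul1r divfK ?gt_eqF.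
- by right.
Qed.

End Step.

(** * Consequences of the invariant for loads and calls *)

Section Bounds.
Variables (j C : nat) (rem w W Y0 best : R) (y x z : 'rV[R]_m).
Variables (N A : nat) (ys : 'rV[R]_m) (Gs G : 'I_n -> 'rV[R]_m) (J : 'rV[R]_m).
Hypothesis hst : stage_inv_at N A ys Gs G J j C rem w W Y0 best y x z.

Let hph := si_ph hst.
Let w_gt0 : 0 < w. Proof. by have := ph_rem hph; lra. Qed.
Let W_ge0 : 0 <= W.
Proof. by apply: le_trans (si_W hst); rewrite mulr_ge0 // ltW. Qed.
Let y_ge0 : nonneg_vec y.
Proof. by move=> r; have := ph_ys hph r; lra. Qed.
Let mR0 : 0 < m%:R :> R. Proof. by rewrite ltr0n. Qed.

(** The logarithm of the exponential lower bound on prices: price growth controls load. *)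
Lemma exp_load_le (E : R) r : y 0 r <= m%:R * expR E ->
  x 0 r <= (1 + e) / e * (ln m%:R + E).
Proof.
move=> h; have := le_trans (ph_exp hph r) h.
rewrite -[X in X * expR E]lnK ?posrE // -expRD ler_expR => h'.
have e1 : 0 < 1 + e by rewrite addr_gt0.
rewrite -[(1 + e) / e]invf_div ler_pdivlMl ?divr_gt0 //.
Qed.

Lemma stage_load_le r :
  x 0 r <= (1 + e) / e * (ln m%:R + e * (2 * (N + A)%:R + 1)).
Proof.
apply: exp_load_le; apply: (@le_trans _ _ (\sum_r y 0 r)).
  by rewrite (bigD1 r) //= lerDl sumr_ge0.
apply: le_trans (si_Y hst) _.
have -> : e * (2 * (N + A)%:R + 1) = e + 2 * e * (N + A)%:R by ring.
rewrite expRD mulrCA ler_pM ?(si_Y0_le hst) ?expR_ge1Dx //.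
  by rewrite addr_ge0 // ltW.
rewrite (si_Y0 hst) sumr_ge0 // => i _; have := ph_ys hph i; lra.
Qed.

Lemma stage_count_le : j%:R <= n%:R * ((N + A)%:R + 1)
  + m%:R * ((1 + e) / e * (ln m%:R + e * (2 * (N + A)%:R + 1))).
Proof.
apply: le_trans (si_j hst) _; apply: lerD.
  rewrite natr1 -natrM ler_nat mulnS addnC leq_add2r; exact: ltnW (si_C hst).
apply: (@le_trans _ _ (\sum_(r < m) (1 + e) / e *
   (ln m%:R + e * (2 * (N + A)%:R + 1)))).
  by apply: ler_sum => r _; exact: stage_load_le.
by rewrite sumr_const card_ord [leRHS]mulr_natl.
Qed.

Lemma scaled_sum_mink (H : 'I_n -> 'rV[R]_m) : 0 < W ->
  (forall D, scaled (X D) W (H D)) -> minkowski_sum X (W^-1 *: \sum_D H D).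
Proof.
move=> W0 hH.
have h D : exists p, X D p /\ H D = W *: p by have [p] := hH D; exists p.
have [g hg] := choice h.
exists g => [D|]; first by case: (hg D).
rewrite scaler_sumr; apply: eq_bigr => D _; have [_ ->] := hg D.
by rewrite scalerA mulVf ?gt_eqF // scale1r.
Qed.

(** The amounts from completed phases, divided by [W], form a feasible solution dominated by
    [x / W]. *)
Lemma lambda_mul_le (B : R) : 0 <= B -> (forall r, x 0 r <= B) -> lam * W <= B.
Proof.
move=> B0 h; have [W0|W0] := ltP 0 W; last first.
  by rewrite (_ : W = 0) ?mulr0 //; apply/eqP; rewrite eq_le W0.
rewrite -ler_pdivlMr //.
apply: (lambda_le_coord hX (scaled_sum_mink W0 (si_Gs hst))).
  by rewrite divr_ge0.
move=> r; rewrite mxE mulrC ler_pM2r ?invr_gt0 //.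
apply: le_trans (h r); rewrite (ph_xE hph) mxE.
apply: ler_wpDl; first exact: (si_J hst).1.
by rewrite !summxE; apply: ler_sum => D _; exact: ph_GsG hph D r.
Qed.

Hypothesis hstop : ~~ (W < Phi * w).

Let at_end : [/\ C = 0%N, rem = w & y = ys].
Proof. by case: (si_stop hst) => // h; move: hstop; rewrite h. Qed.

Hypothesis A0 : A = 0%N.
Hypothesis N0 : (0 < N)%N.

Let NR0 : 0 < N%:R :> R. Proof. by rewrite ltr0n. Qed.

Let wE : w = w0. Proof. by rewrite (si_w hst) A0 expr0 divr1. Qed.

Let WE : W = N%:R * w0. Proof. by rewrite (si_exact hst A0) wE. Qed.

Let W_gt0 : 0 < W. Proof. by rewrite WE mulr_gt0. Qed.

Lemma stage_exit_mink : minkowski_sum X (W^-1 *: x).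
Proof.
rewrite (ph_xE hph) (si_J hst).2 // add0r; apply: scaled_sum_mink => // D.
by have [CE remE _] := at_end; have := ph_G hph D; rewrite CE remE spent0 addr0.
Qed.

(** Compares the price of [r], at least exponential in its load, with the sum over [S], which grew
    by [1 / (1 - t)] per phase. For [t <= 1 / 2] the exponent [t / (1 - t)] is at most
    [t * (1 + 2 * t)]. *)
Lemma stage_exit_load S mu r : 0 <= mu -> local_weak_duality f S mu ->
  r \in S -> e * w0 * mu <= 2^-1 ->
  x 0 r / W <= (1 + e) * (ln m%:R / (e * N%:R * w0)
                          + mu * (1 + 2 * (e * w0 * mu))).
Proof.
move=> mu0 hS rS; set t := e * w0 * mu => ht.
have t0 : 0 <= t by rewrite /t mulr_ge0 // mulr_ge0 // ltW.
have t1 : t < 1 by lra.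
have [_ _ yE] := at_end.
have hx : y 0 r <= m%:R * expR (N%:R * (t / (1 - t))).
  apply: le_trans (si_lwd hst A0 mu0 hS t1).
  rewrite yE (bigD1 r) //= lerDl sumr_ge0 // => i _.
  by rewrite -yE.
have h := exp_load_le hx.
have h2 : t / (1 - t) <= t * (1 + 2 * t).
  rewrite ler_pdivrMr; last lra.
  have : 0 <= t * (t * (1 - 2 * t)) by rewrite mulr_ge0 // mulr_ge0 //; lra.
  by lra.
have e1 : 0 < (1 + e) / e by rewrite divr_gt0 // addr_gt0.
rewrite ler_pdivrMr //; apply: le_trans h _.
apply: (@le_trans _ _ ((1 + e) / e * (ln m%:R + N%:R * (t * (1 + 2 * t))))).
  by rewrite ler_pM2l // lerD2l ler_pM2l.
rewrite le_eqVlt; apply/orP; left; apply/eqP; rewrite WE /t.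
by field; rewrite !gt_eqF.
Qed.

End Bounds.

(** * Guarantees at exit, for a phase weight within constant factors of [1 / lambda_star] *)

Section Exit.
Variables (s : nat) (c l delta : R).
Hypothesis hs : sigma <= s%:R.
Hypothesis hd : 0 < delta <= 1.
Hypothesis eE : e = delta / 8.
Hypothesis c0 : 0 < c.
Hypothesis l1 : 1 <= l.
Hypothesis hl : ln m%:R <= l.
Hypothesis PhiE : Phi = c * l / e ^+ 2.
Hypothesis hw1 : s%:R * (lam * w0) <= 4^-1.
Hypothesis hw2 : 1 <= c * (lam * w0).
Variables (j C : nat) (rem w W Y0 best : R) (y x z : 'rV[R]_m).
Variables (N A : nat) (ys : 'rV[R]_m) (Gs G : 'I_n -> 'rV[R]_m) (J : 'rV[R]_m).
Hypothesis hst : stage_inv_at N A ys Gs G J j C rem w W Y0 best y x z.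
Hypothesis hstop : ~~ (W < Phi * w).

Let lam0 : 0 <= lam. Proof. exact: (lambda_ge0 hX). Qed.

Let l0 : 0 < l. Proof. exact: lt_le_trans l1. Qed.

Let sigma0 : 0 < sigma. Proof. by apply: lt_le_trans hsigma. Qed.

Let e8 : e <= 8^-1. Proof. by rewrite eE; have := hd; lra. Qed.

Let lw0 : 0 <= lam * w0. Proof. by rewrite mulr_ge0 // ltW. Qed.

Let slw : sigma * (lam * w0) <= 4^-1.
Proof. by apply: le_trans hw1; rewrite ler_wpM2r. Qed.

(** An abort would require [2 <= 2 ^+ A < 4 * sigma * lam * w0 <= 1]. *)
Lemma exit_no_abort : A = 0%N.
Proof.
apply/eqP; rewrite -leqn0 leqNgt; apply/negP => /[dup] A0 /(si_A hst).
have : 2 ^+ 1 <= 2 ^+ A :> R by rewrite ler_weXn2l // ler1n.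
have -> : 4 * sigma * lam * w0 = 4 * (sigma * (lam * w0)) by ring.
by rewrite expr1; move: slw; lra.
Qed.

Let A0 := exit_no_abort.

Let wE : w = w0. Proof. by rewrite (si_w hst) A0 expr0 divr1. Qed.

Let WE : W = N%:R * w0. Proof. by rewrite (si_exact hst A0) wE. Qed.

Let e20 : 0 < e ^+ 2. Proof. by rewrite exprn_gt0. Qed.

Let hN : c * l / e ^+ 2 <= N%:R.
Proof. by move: hstop; rewrite -leNgt WE wE ler_pM2r // PhiE. Qed.

Let NR0 : 0 < N%:R :> R.
Proof. by apply: lt_le_trans hN; rewrite divr_gt0 // mulr_gt0. Qed.

Let N0 : (0 < N)%N. Proof. by rewrite -(ltr0n R). Qed.

(** The purpose of running at least [c * l / e ^+ 2] phases: the initial [ln m], spread over them,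
    becomes a term of order [e ^+ 2]. *)
Let ln_le : ln m%:R <= N%:R * e ^+ 2 * (lam * w0).
Proof.
apply: le_trans hl _.
have h1 : c * l <= N%:R * e ^+ 2 by rewrite -ler_pdivrMr.
have h2 : l * 1 <= l * (c * (lam * w0)) by rewrite ler_pM2l.
apply: le_trans (_ : l * (c * (lam * w0)) <= _); first by rewrite -[leLHS]mulr1.
by rewrite mulrA [l * c]mulrC ler_wpM2r.
Qed.

Let ln_term : ln m%:R / (e * N%:R * w0) <= e * lam.
Proof.
rewrite ler_pdivrMr ?mulr_gt0 //; apply: le_trans ln_le _.
by rewrite le_eqVlt; apply/orP; left; apply/eqP; ring.
Qed.

Lemma exit_mink : minkowski_sum X (W^-1 *: x).
Proof. exact: (stage_exit_mink hst hstop A0 N0). Qed.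

(** The load bound for all resources with [mu = sigma * lam]; the error factor
    [(1 + e) * (1 + 3 / 2 * e)] fits below [1 + 8 * e]. *)
Lemma exit_norm : `|W^-1 *: x| <= (1 + delta) * sigma * lam.
Proof.
have B0 : 0 <= (1 + delta) * sigma * lam.
  by rewrite mulr_ge0 // mulr_ge0 ?(ltW sigma0) //; move: hd; lra.
apply: norm_le_coord => // r.
have Wx : 0 <= (W^-1 *: x) 0 r by exact: (mink_ge0 hX exit_mink).
rewrite ger0_norm // mxE mulrC.
have ht : e * w0 * (sigma * lam) = e * (sigma * (lam * w0)) by ring.
have sl0 : 0 <= sigma * lam by rewrite mulr_ge0 // ltW.
have t4 : e * w0 * (sigma * lam) <= e / 4 by rewrite ht ler_pM2l.
have t2 : e * w0 * (sigma * lam) <= 2^-1 by move: e8; lra.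
have := stage_exit_load hst hstop A0 N0 sl0 (weak_duality_setT hX hf hsigma)
  (finset.in_setT r) t2.
move/le_trans; apply.
apply: (@le_trans _ _ ((1 + e) * (e * (sigma * lam) + sigma * lam * (1 + e / 2)))).
  have ee : 0 < 1 + e by rewrite addr_gt0.
  rewrite ler_pM2l //; apply: lerD.
    apply: le_trans ln_term _; rewrite ler_pM2l // ler_peMl //.
  by rewrite ler_wpM2l //; lra.
have dE : delta = 8 * e by rewrite eE; lra.
rewrite -[leRHS]mulrA dE.
have -> : (1 + e) * (e * (sigma * lam) + sigma * lam * (1 + e / 2))
   = ((1 + e) * (1 + 3 / 2 * e)) * (sigma * lam) by field.
rewrite ler_wpM2r //; move: e8 e0; nra.
Qed.

Lemma exit_lwd S mu : 0 <= mu -> local_weak_duality f S mu ->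
  \big[Num.max/0]_(r in S) (W^-1 *: x) 0 r <= mu + delta * Num.max lam mu.
Proof.
move=> mu0 hS.
have d0 : 0 < delta by case/andP: hd.
have M0 : 0 <= Num.max lam mu by rewrite le_max lam0.
apply/bigmax_leP; split; first by rewrite addr_ge0 // mulr_ge0 // ltW.
move=> r rS.
(* The load bound requires [e * w0 * mu] to be small. For larger [mu] the norm bound suffices, as
   [1 + delta <= 2]. *)
have [hmu|hmu] := leP mu (2 * (sigma * lam)); last first.
  apply: le_trans (_ : 2 * (sigma * lam) <= _); last first.
    by apply: ler_wpDr; [rewrite mulr_ge0 // ltW|exact: ltW].
  apply: le_trans (ler_norm _) _; apply: le_trans (norm_ge_coord _ r) _.
  apply: le_trans exit_norm _; rewrite -mulrA ler_wpM2r //.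
    by rewrite mulr_ge0 // ltW.
  by move: hd; lra.
have ht : e * w0 * (2 * (sigma * lam)) = 2 * e * (sigma * (lam * w0)) by ring.
have t4 : e * w0 * mu <= e / 2.
  apply: le_trans (_ : e * w0 * (2 * (sigma * lam)) <= _).
    by rewrite ler_pM2l // mulr_gt0.
  have : 2 * e * (sigma * (lam * w0)) <= 2 * e * 4^-1.
    by rewrite ler_pM2l // mulr_gt0.
  by rewrite ht; lra.
have t2 : e * w0 * mu <= 2^-1 by move: e8; lra.
rewrite mxE mulrC; have := stage_exit_load hst hstop A0 N0 mu0 hS rS t2.
move/le_trans; apply; set M := Num.max lam mu in M0 *.
have lM : lam <= M by rewrite le_max lexx.
have mM : mu <= M by rewrite le_max lexx orbT.
have ee : 0 < 1 + e by rewrite addr_gt0.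
apply: (@le_trans _ _ ((1 + e) * (e * M + (mu + e * M)))).
  rewrite ler_pM2l //; apply: lerD.
    by apply: le_trans ln_term _; rewrite ler_pM2l.
  rewrite mulrDr mulr1 lerD2l.
  apply: (@le_trans _ _ (mu * e)); last by rewrite mulrC ler_pM2l.
  by rewrite ler_wpM2l //; lra.
have -> : delta = 8 * e by rewrite eE; lra.
have h1 : e * mu <= e * M by rewrite ler_pM2l.
have h2 : e * (e * M) <= 1 * (e * M).
  rewrite ler_wpM2r //; first by rewrite mulr_ge0 // ltW.
  by move: e8; lra.
have h3 : 0 <= e * M by rewrite mulr_ge0 // ltW.
by lra.
Qed.

(** The [N] phases together raise some load to at least [lam * W], so the phase of largest growth
    has [ln best] of order [e * lam * w0]. That growth is in turn bounded by the block optima at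
    [z], which forces the dual value to be large. *)
Lemma exit_dual : simplex z /\
  (1 - delta) * (lam / sigma) <= min_dot (minkowski_sum X) z.
Proof.
have [zS b0 hb] := si_z hst A0 N0; split=> //.
have z0 : nonneg_vec z by move=> r; have [/(_ r)/andP[]] := zS.
apply: le_trans (sum_opt_le_min_dot hX z0).
move: lw0 slw ln_le; set v := lam * w0 => v0 sv lnv.
have bN : (0 < m%:R * best ^+ N) by rewrite mulr_gt0 ?ltr0n // exprn_gt0.
have mR0 : 0 < m%:R :> R by rewrite ltr0n.
have [_ _ hY0] := si_best hst A0.
have y_le r : y 0 r <= m%:R * best ^+ N.
  apply: le_trans hY0; rewrite (si_Y0 hst).
  have [_ _ yE] : [/\ C = 0%N, rem = w & y = ys].
    by case: (si_stop hst) => // h; move: hstop; rewrite h.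
  have h i : 0 <= y 0 i by have := ph_ys (si_ph hst) i; lra.
  by rewrite -yE (bigD1 r) //= lerDl sumr_ge0.
have e1 : 0 < 1 + e by rewrite addr_gt0.
have hx r : x 0 r <= (1 + e) / e * (ln m%:R + N%:R * ln best).
  apply: (exp_load_le hst); rewrite [N%:R * _]mulr_natl -lnXn // lnK ?posrE ?exprn_gt0 //.
have hB : 0 <= (1 + e) / e * (ln m%:R + N%:R * ln best).
  by apply: le_trans (hx (Ordinal m0)); exact: ph_x0 (si_ph hst) _.
have := lambda_mul_le hst hB hx.
rewrite WE mulrCA -/v -[(1 + e) / e]invf_div ler_pdivlMl ?divr_gt0 // => hlog.
(* Division by [N], with [ln m] absorbed by [ln_le]. *)
have h0 : v * (e / (1 + e) - e ^+ 2) <= ln best.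
  rewrite -(ler_pM2l NR0); move: lnv hlog; lra.
have h1 : v * (e * (1 - 2 * e)) <= ln best.
  apply: le_trans h0; rewrite ler_wpM2l //.
  have : e * (1 - e) <= e / (1 + e).
    rewrite ler_pdivlMr // -mulrA ler_piMr ?(ltW e0) //.
    by move: e0; nra.
  by lra.
set h := v * (e * (1 - 2 * e)) in h1.
have hh0 : 0 <= h by rewrite mulr_ge0 // mulr_ge0 ?(ltW e0) //; move: e8; lra.
have v1 : v <= 1.
  have : 1 * v <= sigma * v by rewrite ler_wpM2r.
  by move: sv; lra.
have h2 : best^-1 <= (1 + h)^-1.
  rewrite lef_pV2 ?posrE //; last lra.
  apply: le_trans (expR_ge1Dx h) _.
  by rewrite -[leRHS]lnK ?posrE // ler_expR.
have he : h <= e.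
  rewrite /h mulrCA ler_piMr ?(ltW e0) //.
  apply: le_trans (_ : v * 1 <= _); last by rewrite mulr1.
  by rewrite ler_wpM2l //; move: e0; lra.
(* From [h <= e], since [(1 - e) * (1 + h) <= 1]. *)
have h3 : h * (1 - e) <= 1 - (1 + h)^-1.
  have -> : 1 - (1 + h)^-1 = h / (1 + h) by field; rewrite gt_eqF //; lra.
  rewrite ler_pdivlMr; last lra.
  rewrite -mulrA ler_piMr //.
  by move: e0 he hh0; nra.
have h4 : h * (1 - e) <= e * w0 * sigma * \sum_D opt X D z.
  by apply: le_trans hb; lra.
have ews : 0 < e * w0 * sigma by rewrite !mulr_gt0.
rewrite -(ler_pM2l ews); apply: le_trans h4.
have -> : e * w0 * sigma * ((1 - delta) * (lam / sigma)) = v * e * (1 - delta).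
  by rewrite /v; field; rewrite gt_eqF.
rewrite /h -!mulrA ler_wpM2l // ler_pM2l //.
have -> : delta = 8 * e by rewrite eE; lra.
by move: e0; nra.
Qed.

End Exit.
End Stage.

(** * Total correctness of programs *)

Definition For (c : cmd) : cmd :=
  Seq (ISet 3 (ICst 0))
    (While (BILt (IVar 3) (IVar 1)) (Seq c (ISet 3 (IAdd (IVar 3) (ICst 1))))).

Section Runs.
Variables (R : realType) (n m : nat) (f : 'I_n -> 'rV[R]_m -> 'rV[R]_m).
Implicit Types (s : state R) (Q : state R -> Prop) (c : cmd) (t q : nat).

(** A total-correctness triple in which [t] bounds the steps from above but [q] is the exact number
    of calls, so that calls can be identified with loop iterations. *)
Definition runs c s t q Q :=
  exists s' t', [/\ exec f c s s' t' q, (t' <= t)%N & Q s'].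

Lemma runs_le c s t t' q Q Q' : runs c s t q Q -> (t <= t')%N ->
  (forall s', Q s' -> Q' s') -> runs c s t' q Q'.
Proof.
move=> [s' [u [h hu hQ]]] htt hQQ; exists s', u; split=> //.
  exact: leq_trans htt.
exact: hQQ.
Qed.

Lemma runs_weak t c s t' q Q : (t <= t')%N -> runs c s t q Q -> runs c s t' q Q.
Proof. by move=> h /runs_le; apply. Qed.

Lemma runs_seq c1 c2 s t1 t2 q1 q2 Q1 Q :
  runs c1 s t1 q1 Q1 -> (forall s1, Q1 s1 -> runs c2 s1 t2 q2 Q) ->
  runs (Seq c1 c2) s (t1 + t2) (q1 + q2) Q.
Proof.
move=> [s1 [u1 [h1 hu1 hQ1]]] /(_ _ hQ1) [s2 [u2 [h2 hu2 hQ]]].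
exists s2, (u1 + u2)%N; split=> //; first exact: ExecSeq h1 h2.
exact: leq_add.
Qed.

Lemma runs_bind c1 c2 s t1 t2 q Q1 Q :
  runs c1 s t1 0 Q1 -> (forall s1, Q1 s1 -> runs c2 s1 t2 q Q) ->
  runs (Seq c1 c2) s (t1 + t2) q Q.
Proof. exact: runs_seq. Qed.

Lemma runs_skip s Q : Q s -> runs Skip s 1 0 Q.
Proof. by move=> h; exists s, 1%N; split=> //; exact: ExecSkip. Qed.

Lemma runs_iset s v e Q : Q (set_ivar s v (ieval s e)) -> runs (ISet v e) s 1 0 Q.
Proof. by move=> h; eexists; exists 1%N; split; first exact: ExecISet. Qed.

Lemma runs_rset s a i e Q : Q (set_rmem s a (ieval s i) (reval s e)) ->
  runs (RSet a i e) s 1 0 Q.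
Proof. by move=> h; eexists; exists 1%N; split; first exact: ExecRSet. Qed.

Lemma runs_iset_seq s v e c t q Q :
  runs c (set_ivar s v (ieval s e)) t q Q -> runs (Seq (ISet v e) c) s t.+1 q Q.
Proof.
move=> h; rewrite -add1n.
by apply: (@runs_bind _ _ _ _ _ _ (eq (set_ivar s v (ieval s e))));
  [exact: runs_iset|move=> _ <-].
Qed.

Lemma runs_rset_seq s a i e c t q Q :
  runs c (set_rmem s a (ieval s i) (reval s e)) t q Q ->
  runs (Seq (RSet a i e) c) s t.+1 q Q.
Proof.
move=> h; rewrite -add1n.
by apply: (@runs_bind _ _ _ _ _ _ (eq (set_rmem s a (ieval s i) (reval s e))));
  [exact: runs_rset|move=> _ <-].
Qed.

Lemma runs_call_seq s e p a c t (C : 'I_n) Q :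
  ieval s e = C -> nonneg_vec (read_vec m s p) ->
  runs c (write_vec s a (f C (read_vec m s p))) t 0 Q ->
  runs (Seq (Call e p a) c) s t.+1 1 Q.
Proof.
move=> hC hp h; rewrite -add1n -[X in runs _ _ _ X]addn0.
apply: (@runs_seq _ _ _ _ _ _ _ (eq (write_vec s a (f C (read_vec m s p)))));
  last by move=> _ <-.
by eexists; exists 1%N; split=> //; exact: ExecCall hC hp.
Qed.

Lemma runs_if b c1 c2 s t q Q :
  (beval s b -> runs c1 s t q Q) -> (~~ beval s b -> runs c2 s t q Q) ->
  runs (If b c1 c2) s t.+1 q Q.
Proof.
move=> h1 h2; case: (boolP (beval s b)) => hb.
  have [s' [u [h hu hQ]]] := h1 hb; exists s', u.+1; split=> //.
  exact: ExecIfTrue.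
have [s' [u [h hu hQ]]] := h2 hb; exists s', u.+1; split=> //.
exact: ExecIfFalse.
Qed.

(** The invariant is indexed by the iterations made. That it holds for no index beyond [B] forces
    termination, while the cost is stated in the actual number [j], which the invariant may bound
    more sharply afterwards. *)
Lemma runs_while b c k t B (I : nat -> state R -> Prop) s :
  (forall j s1, I j s1 -> beval s1 b -> runs c s1 t k (I j.+1)) ->
  (forall j s1, I j s1 -> (j <= B)%N) -> I 0%N s ->
  exists j, runs (While b c) s (t.+1 * j + 1) (k * j)
    (fun s' => I j s' /\ ~~ beval s' b).
Proof.
move=> hstep hB I0.
suff h d i s1 : I i s1 -> (B - i <= d)%N -> exists j,
    runs (While b c) s1 (t.+1 * j + 1) (k * j)
      (fun s' => I (i + j)%N s' /\ ~~ beval s' b).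
  by have [j hj] := h B 0%N s I0 (leq_subr _ _); exists j.
elim: d i s1 => [|d IH] i s1 hi hd; case: (boolP (beval s1 b)) => hb.
- have [s2 [u [_ _ /hB]]] := hstep _ _ hi hb; lia.
- exists 0%N, s1, 1%N; split; rewrite ?muln0 ?addn0 //.
  exact: ExecWhileFalse.
- have [s2 [u [h hu hi']]] := hstep _ _ hi hb.
  have [|j [s3 [v [h' hv [hI hnb]]]]] := IH _ _ hi'; first by lia.
  exists j.+1, s3, (u + v).+1; split.
  + rewrite mulnS; exact: ExecWhileTrue h h'.
  + rewrite mulnS; lia.
  + by rewrite addnS.
- exists 0%N, s1, 1%N; split; rewrite ?muln0 ?addn0 //.
  exact: ExecWhileFalse.
Qed.

Lemma runs_for c t (I : nat -> state R -> Prop) s :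
  ivar s 1 = m -> I 0%N (set_ivar s 3 0) ->
  (forall r s1, (r < m)%N -> ivar s1 3 = r -> ivar s1 1 = m -> I r s1 ->
    runs c s1 t 0 (fun s2 => [/\ ivar s2 3 = r, ivar s2 1 = m
                               & I r.+1 (set_ivar s2 3 r.+1)])) ->
  runs (For c) s ((t + 2) * m + 2) 0 (I m).
Proof.
move=> hm I0 hstep.
pose I' j s1 := [/\ (j <= m)%N, ivar s1 3 = j, ivar s1 1 = m & I j s1].
have hI0 : I' 0%N (set_ivar s 3 0) by [].
have [||j hj] := @runs_while (BILt (IVar 3) (IVar 1))
    (Seq c (ISet 3 (IAdd (IVar 3) (ICst 1)))) 0 (t + 1) m I' _ _ _ hI0.
- move=> j s1 [jm h3 h1 hI] /=; rewrite h3 h1 => hlt.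
  apply: (runs_bind (hstep _ _ hlt h3 h1 hI)) => s2 [h3' h1' hI'].
  by apply: runs_iset => /=; rewrite h3' addn1; split.
- by move=> j s1 [].
have [s' [u [h hu [[jm h3 h1 hI] hnb]]]] := hj.
have jE : j = m by move: hnb => /=; rewrite h3 h1; lia.
rewrite (_ : ((t + 2) * m + 2)%N = ((t + 1).+1 * m + 1).+1); last by lia.
by apply: runs_iset_seq; exists s', u; rewrite jE in hu hI.
Qed.

(** A frame condition; register 3 is exempt because it is the index of every [For]. *)
Definition changed (P : nat -> nat -> bool) s s' :=
  (forall v, v != 3%N -> ivar s' v = ivar s v) /\
  (forall b j, ~~ P b j -> rmem s' b j = rmem s b j).

Lemma runs_map a e (v : nat -> R) s : ivar s 1 = m ->
  (forall r s1, (r < m)%N -> ivar s1 3 = r ->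
     changed (fun b j => (b == a) && (j < r)%N) s s1 -> reval s1 e = v r) ->
  runs (For (RSet a (IVar 3) e)) s (3 * m + 2) 0
    (fun s' => changed (fun b _ => b == a) s s' /\ read_vec m s' a = \row_(r < m) v r).
Proof.
move=> hm hv.
pose I r s1 := changed (fun b j => (b == a) && (j < r)%N) s s1 /\
  forall i, (i < r)%N -> rmem s1 a i = v i.
have : runs (For (RSet a (IVar 3) e)) s ((1 + 2) * m + 2) 0 (I m).
  apply: runs_for => //.
    split=> //; split=> [u hu|b j]; last by rewrite ltn0 andbF.
    by rewrite /= (negbTE hu).
  move=> r s1 rm h3 h1 [[hc1 hc2] hI]; apply: runs_rset; split=> //.
  have E := hv _ _ rm h3 (conj hc1 hc2).
  split; [split=> [u hu|b j] /=|move=> i] => /=.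
  - by rewrite (negbTE hu) hc1.
  - rewrite h3 ltnS leq_eqVlt; have [_|ba] := eqVneq b a; last by rewrite hc2 // (negbTE ba).
    by case: eqP => //= _ hj; rewrite hc2 // (negbTE hj) andbF.
  - rewrite h3 eqxx /= ltnS leq_eqVlt E; case: eqP => [-> //|_ /= hi].
    exact: hI.
move=> h; apply: runs_le h _ _ => // s' [[h1 h2] h3]; split.
  by split=> // b j hb; apply: h2; rewrite (negbTE hb).
by apply/rowP => r; rewrite !mxE h3.
Qed.

Lemma runs_fold c k t (F : nat -> R -> R) s : ivar s 1 = m ->
  (forall r s1, (r < m)%N -> ivar s1 3 = r ->
     changed (fun b j => (b == 0%N) && (j == k)) s s1 ->
     runs c s1 t 0 (eq (set_rmem s1 0 k (F r (rmem s1 0 k))))) ->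
  runs (For c) s ((t + 2) * m + 2) 0
    (fun s' => changed (fun b j => (b == 0%N) && (j == k)) s s' /\
       rmem s' 0 k = iteri m F (rmem s 0 k)).
Proof.
move=> hm hF.
apply: (@runs_for _ _ (fun r s1 => changed (fun b j => (b == 0%N) && (j == k)) s s1 /\
       rmem s1 0 k = iteri r F (rmem s 0 k))) => //.
  by split=> //; split=> // u hu; rewrite /= (negbTE hu).
move=> r s1 rm h3 h1 [[hc1 hc2] hI].
apply: runs_le (hF _ _ rm h3 (conj hc1 hc2)) _ _ => // _ <-; split=> //.
split=> /=; last by rewrite !eqxx hI.
split=> [u hu|b j hb] /=; first by rewrite (negbTE hu) hc1.
by rewrite (negbTE hb) hc2.
Qed.

Lemma set_rmem_id s a i : set_rmem s a i (rmem s a i) = s.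
Proof.
case: s => iv rm; rewrite /set_rmem /=; congr State.
by apply/funext => b; apply/funext => j; case: ifP => // /andP[/eqP-> /eqP->].
Qed.

Lemma read_write s a (v : 'rV[R]_m) : read_vec m (write_vec s a v) a = v.
Proof.
apply/rowP => r; rewrite mxE /= eqxx; case: insubP => [r' _ E|]; last by rewrite ltn_ord.
by congr (v 0 _); exact: val_inj.
Qed.

Definition Sum (a k : nat) : cmd :=
  Seq (RSet 0 (ICst k) (RCst 0))
    (For (RSet 0 (ICst k) (RAdd (RGet 0 (ICst k)) (RGet a (IVar 3))))).

Lemma iteri_sum (v : nat -> R) k : iteri k (fun r acc => acc + v r) 0 = \sum_(r < k) v r.
Proof. by elim: k => [|k IH]; rewrite ?big_ord0 // big_ord_recr /= IH. Qed.

Lemma runs_Sum a k s : ivar s 1 = m -> a != 0%N ->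
  runs (Sum a k) s (3 * m + 3) 0
    (fun s' => changed (fun b j => (b == 0%N) && (j == k)) s s' /\
       rmem s' 0 k = \sum_r read_vec m s a 0 r).
Proof.
move=> hm ha; rewrite (_ : (3 * m + 3)%N = (3 * m + 2).+1); last lia.
apply: runs_rset_seq.
set s0 := set_rmem _ _ _ _.
apply: runs_le (@runs_fold _ k 1 (fun r acc => acc + rmem s a r) s0 _ _) _ _ => //.
- move=> r s1 rm h3 [hc1 hc2].
  have E : rmem s1 a r = rmem s a r by rewrite hc2 /= (negbTE ha).
  by apply: runs_rset => /=; rewrite h3 E.
- move=> s' [[h1 h2] h3]; split.
    split=> [u hu|b j hb]; first by rewrite h1.
    by rewrite h2 //= (negbTE hb).
  rewrite h3 /= !eqxx /= iteri_sum; apply: eq_bigr => r _; by rewrite mxE.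
Qed.

(** The start value 0 may survive, but a positive result is one of the entries, which is what the
    choice of the step size requires. *)
Definition max_upto (v : nat -> R) k : R :=
  iteri k (fun r acc => if acc < v r then v r else acc) 0.

Lemma max_upto_ge v k r : (r < k)%N -> v r <= max_upto v k.
Proof.
elim: k => // k IH; rewrite ltnS leq_eqVlt /max_upto /= -/(max_upto v k).
case: ltP => h /predU1P[->|/IH h'] //; exact: le_trans h' (ltW h).
Qed.

Lemma max_upto_attained v k : max_upto v k = 0 \/ exists2 r, (r < k)%N & max_upto v k = v r.
Proof.
elim: k => [|k IH]; first by left.
rewrite /max_upto /= -/(max_upto v k); case: ltP => _; first by right; exists k.
by case: IH => [->|[r hr ->]]; [left|right; exists r => //; exact: ltnW].
Qed.

Definition Max (a k : nat) : cmd :=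
  Seq (RSet 0 (ICst k) (RCst 0))
    (For (If (BRLt (RGet 0 (ICst k)) (RGet a (IVar 3)))
       (RSet 0 (ICst k) (RGet a (IVar 3))) Skip)).

Lemma runs_Max a k s : ivar s 1 = m -> a != 0%N ->
  runs (Max a k) s (4 * m + 3) 0
    (fun s' => changed (fun b j => (b == 0%N) && (j == k)) s s' /\
       rmem s' 0 k = max_upto (rmem s a) m).
Proof.
move=> hm ha; rewrite (_ : (4 * m + 3)%N = (4 * m + 2).+1); last lia.
apply: runs_rset_seq.
set s0 := set_rmem _ _ _ _.
apply: runs_le (@runs_fold _ k 2
  (fun r acc => if acc < rmem s a r then rmem s a r else acc) s0 _ _) _ _ => //.
- move=> r s1 rm h3 [hc1 hc2].
  have E : rmem s1 a r = rmem s a r by rewrite hc2 /= (negbTE ha).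
  apply: runs_if => /=; rewrite h3 E => h.
    by apply: runs_rset; rewrite /= h3 E h.
  by apply: runs_skip; rewrite (negbTE h) set_rmem_id.
- move=> s' [[h1 h2] h3]; split.
    split=> [u hu|b j hb]; first by rewrite h1.
    by rewrite h2 //= (negbTE hb).
  by rewrite h3 /= !eqxx.
Qed.

End Runs.

(** * The program *)

(* Registers: 0 n, 1 m, 2 current customer, 3 loop index, 4 power of two.
   Arrays: 1 loads, 2 dual solution, 3 prices, 4 oracle answer. Array 0 holds
   the scalars: 0 delta, 1 epsilon, 2 Phi, 3 phase weight w, 4 total weight W,
   5 weight left for the current customer, 6 sum of the prices, 7 the same at
   the start of the phase, 8 best growth factor, 9 maximum of the answer,
   10 step size, 11 logarithm of m, 12 sum of the first loads. *)
Definition sc (k : nat) : rexpr := RGet 0 (ICst k).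
Definition SSet (k : nat) (e : rexpr) : cmd := RSet 0 (ICst k) e.
Definition ent (a : nat) : rexpr := RGet a (IVar 3).

(** The test is in product form, so that division by the maximum happens only when it is positive. A
    step of [1 / max] adds exactly 1 to the largest entry's load; otherwise the remaining weight
    finishes the customer. *)
Definition pick_step : cmd :=
  If (BRLt (RCst 1) (RMul (sc 5) (sc 9)))
    (Seq (SSet 10 (RDiv (RCst 1) (sc 9))) (SSet 5 (RSub (sc 5) (sc 10))))
    (Seq (SSet 10 (sc 5))
      (Seq (SSet 5 (sc 3)) (ISet 2 (IAdd (IVar 2) (ICst 1))))).

Definition oracle_step : cmd :=
  Seq (Call (IVar 2) 3 4) (Seq (Max 4 9) (Seq pick_step
  (Seq (For (RSet 1 (IVar 3) (RAdd (ent 1) (RMul (sc 10) (ent 4)))))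
  (Seq (For (RSet 3 (IVar 3) (RMul (ent 3)
         (RAdd (RCst 1) (RMul (sc 1) (RMul (sc 10) (ent 4)))))))
       (Sum 3 6))))).

Definition record_dual : cmd :=
  If (BRLt (RMul (sc 8) (sc 7)) (sc 6))
    (Seq (SSet 8 (RDiv (sc 6) (sc 7)))
         (For (RSet 2 (IVar 3) (RDiv (ent 3) (sc 6)))))
    Skip.

(** The abort test comes first: a phase whose last step exceeds the limit is aborted even if all
    customers have been served. *)
Definition end_phase : cmd :=
  If (BRLt (RMul (RAdd (RCst 1) (sc 1)) (sc 7)) (sc 6))
    (Seq (SSet 3 (RDiv (sc 3) (RCst 2))) (Seq (SSet 5 (sc 3))
      (Seq (ISet 2 (ICst 0)) (SSet 7 (sc 6)))))
    (If (BILt (IVar 2) (IVar 0)) Skip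
      (Seq record_dual (Seq (SSet 4 (RAdd (sc 4) (sc 3))) (Seq (SSet 5 (sc 3))
        (Seq (ISet 2 (ICst 0)) (SSet 7 (sc 6))))))).

Definition stage_init_cmd : cmd :=
  Seq (For (RSet 3 (IVar 3) (RCst 1))) (Seq (For (RSet 1 (IVar 3) (RCst 0)))
  (Seq (Sum 3 6) (Seq (SSet 7 (sc 6)) (Seq (SSet 4 (RCst 0))
  (Seq (SSet 5 (sc 3)) (Seq (SSet 8 (RCst 0)) (ISet 2 (ICst 0)))))))).

Definition stage_loop : cmd :=
  While (BRLt (sc 4) (RMul (sc 2) (sc 3))) (Seq oracle_step end_phase).

(** * Correctness of the oracle step *)

Section Program.
Variables (R : realType) (n m : nat) (f : 'I_n -> 'rV[R]_m -> 'rV[R]_m).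
Implicit Types (s : state R) (x y z : 'rV[R]_m).

Record stage_mem (delta l e Phi : R) (C : nat) (rem w W Y0 best : R) y x z s :
    Prop := StageMem {
  sm_n : ivar s 0 = n; sm_m : ivar s 1 = m; sm_C : ivar s 2 = C;
  sm_d : rmem s 0 0 = delta; sm_l : rmem s 0 11 = l;
  sm_e : rmem s 0 1 = e; sm_Phi : rmem s 0 2 = Phi;
  sm_w : rmem s 0 3 = w; sm_W : rmem s 0 4 = W; sm_rem : rmem s 0 5 = rem;
  sm_Y0 : rmem s 0 7 = Y0; sm_best : rmem s 0 8 = best;
  sm_y : read_vec m s 3 = y; sm_x : read_vec m s 1 = x;
  sm_z : read_vec m s 2 = z }.

Lemma read_vec_ext s s' a : (forall j, rmem s' a j = rmem s a j) ->
  read_vec m s' a = read_vec m s a.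
Proof. by move=> h; apply/rowP => r; rewrite !mxE. Qed.

Section Body.
Variables (delta l e Phi : R) (C : 'I_n) (rem w W Y0 best : R) (y x z : 'rV[R]_m).
Hypothesis y0 : nonneg_vec y.
Let b := f C y.

Definition step_size (mx : R) := if 1 < rem * mx then 1 / mx else rem.
Definition next_C (mx : R) : nat := if 1 < rem * mx then C : nat else C.+1.
Definition next_rem (mx : R) := if 1 < rem * mx then rem - step_size mx else w.
Definition next_x (mx : R) : 'rV[R]_m := \row_r (x 0 r + step_size mx * b 0 r).
Definition next_y (mx : R) := bump_prices e (step_size mx) b y.

Lemma runs_pick_step s mx : ivar s 2 = C -> rmem s 0 9 = mx ->
  rmem s 0 5 = rem -> rmem s 0 3 = w ->
  runs f pick_step s 4 0 (fun s' =>
   [/\ forall v, v != 2%N -> ivar s' v = ivar s v,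
       ivar s' 2 = next_C mx, rmem s' 0 10 = step_size mx,
       rmem s' 0 5 = next_rem mx &
       forall a j, ~~ ((a == 0%N) && ((j == 10%N) || (j == 5%N))) ->
         rmem s' a j = rmem s a j]).
Proof.
move=> hC h9 h5 h3.
rewrite /next_C /next_rem /step_size.
apply: runs_if => /=; rewrite h5 h9 => h; rewrite ?h ?(negbTE h).
  apply: (@runs_weak _ _ _ _ 2) => //.
  apply: runs_rset_seq; apply: runs_rset; rewrite /= !h5 h9; split=> //.
  move=> a j; case: (a == _) => //=; by case: (j == 5%N); case: (j == 10%N).
apply: runs_rset_seq; apply: runs_rset_seq; apply: runs_iset.
rewrite /= h5 h3 hC addn1; split=> //.
- by move=> v /negbTE ->.
- move=> a j; case: (a == _) => //=; by case: (j == 5%N); case: (j == 10%N).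
Qed.

Lemma runs_oracle_step s :
  stage_mem delta l e Phi C rem w W Y0 best y x z s ->
  runs f oracle_step s (13 * m + 15) 1 (fun s' => exists mx : R,
    [/\ forall r, b 0 r <= mx,
        mx = 0 \/ exists r, mx = b 0 r,
        stage_mem delta l e Phi (next_C mx) (next_rem mx) w W Y0 best
          (next_y mx) (next_x mx) z s'
      & rmem s' 0 6 = \sum_r next_y mx 0 r]).
Proof.
move=> hs; eapply runs_weak; last first.
  eapply (runs_call_seq (C := C)); first exact: sm_C hs.
    by rewrite (sm_y hs).
  rewrite (sm_y hs) -/b; set s1 := write_vec _ _ _.
  have s1b : read_vec m s1 4 = b by exact: read_write.
  have s1r a j : a != 4%N -> rmem s1 a j = rmem s a j by move=> /negbTE /= ->.
  eapply runs_bind; first by apply: (@runs_Max _ _ _ _ 4 9 s1) => //; exact: sm_m hs.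
  move=> s2 /= [[i2 r2] mxE2]; set mx := max_upto _ _ in mxE2.
  have h2 a j : a != 4%N -> ~~ ((a == 0%N) && (j == 9%N)) -> rmem s2 a j = rmem s a j.
    by move=> ha hj; rewrite r2 // s1r.
  eapply runs_bind.
    apply: (@runs_pick_step s2 mx) => //.
    - by rewrite i2 //; exact: sm_C hs.
    - by rewrite h2 //; exact: sm_rem hs.
    - by rewrite h2 //; exact: sm_w hs.
  move=> s3 /= [i3 C3 xi3 rem3 r3].
  have m3 : ivar s3 1 = m by rewrite i3 // i2 //; exact: sm_m hs.
  eapply runs_bind.
    apply: (@runs_map _ _ _ _ 1 _ (fun r => rmem s 1 r + step_size mx * rmem s1 4 r)) => //.
    move=> r s' rm h [_ hr] /=; rewrite h !hr //= ?ltnn // ?andbF //.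
    by rewrite xi3 !r3 // h2 // r2.
  move=> s4 /= [[i4 r4] v4].
  eapply runs_bind.
    apply: (@runs_map _ _ _ _ 3 _ (fun r => rmem s 3 r *
       (1 + e * (step_size mx * rmem s1 4 r)))); first by rewrite i4.
    move=> r s' rm h [_ hr] /=; rewrite h !hr //= ?ltnn // ?andbF //.
    by rewrite !r4 // xi3 !r3 // (h2 3%N) // (h2 0%N) // r2 // (sm_e hs).
  move=> s5 /= [[i5 r5] v5].
  eapply runs_le; [apply: (@runs_Sum _ _ _ _ 3 6) => //| exact: leqnn|].
    by rewrite i5 // i4.
  move=> s6 /= [[i6 r6] Y6]; exists mx.
  have bE (r : 'I_m) : rmem s1 4 r = b 0 r by rewrite -s1b mxE.
  have yE (r : 'I_m) : rmem s 3 r = y 0 r by rewrite -(sm_y hs) mxE.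
  have xE (r : 'I_m) : rmem s 1 r = x 0 r by rewrite -(sm_x hs) mxE.
  have y5 : read_vec m s5 3 = next_y mx.
    by rewrite v5; apply/rowP => r; rewrite /next_y /bump_prices !mxE -bE -yE.
  have x4 : read_vec m s4 1 = next_x mx.
    by rewrite v4; apply/rowP => r; rewrite /next_x !mxE -bE -xE.
  have I6 v : v != 3%N -> v != 2%N -> ivar s6 v = ivar s v.
    by move=> hv hv'; rewrite i6 // i5 // i4 // i3 // i2.
  have R6 k : k != 6%N -> k != 10%N -> k != 5%N -> k != 9%N -> rmem s6 0 k = rmem s 0 k.
    move=> k6 k10 k5 k9.
    by rewrite r6 ?(negbTE k6) // r5 // r4 // r3 ?(negbTE k10) ?(negbTE k5) // h2 ?(negbTE k9).
  split.
  - by move=> r; rewrite -bE; exact: max_upto_ge.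
  - case: (max_upto_attained (rmem s1 4) m) => [h|[r rm h]]; first by left.
    by right; exists (Ordinal rm); rewrite -bE -[RHS]h.
  - split; try by rewrite ?I6 ?R6 //; case: hs.
    + by rewrite i6 // i5 // i4 // C3.
    + by rewrite r6 // r5 // r4.
    + by rewrite -y5; apply: read_vec_ext => j; rewrite r6.
    + by rewrite -x4; apply: read_vec_ext => j; rewrite r6 // r5.
    + rewrite -(sm_z hs); apply: read_vec_ext => j.
      by rewrite r6 // r5 // r4 // r3 // h2.
  - by rewrite Y6 y5.
lia.
Qed.

End Body.
End Program.

(** * Correctness of phase ends and of whole stages *)

Section StageProgram.
Variables (R : realType) (n m : nat) (f : 'I_n -> 'rV[R]_m -> 'rV[R]_m).
Implicit Types (s : state R) (x y z : 'rV[R]_m).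

Lemma runs_record_dual delta l e Phi C rem w W Y0 best y x z Y s :
  stage_mem n delta l e Phi C rem w W Y0 best y x z s -> rmem s 0 6 = Y ->
  runs f record_dual s (3 * m + 4) 0 (fun s' =>
    stage_mem n delta l e Phi C rem w W Y0
      (if best * Y0 < Y then Y / Y0 else best) y x
      (if best * Y0 < Y then \row_r (y 0 r / Y) else z) s' /\ rmem s' 0 6 = Y).
Proof.
move=> hs hY; rewrite (_ : (3 * m + 4)%N = (3 * m + 3).+1); last lia.
apply: runs_if => /=; rewrite hY (sm_Y0 hs) (sm_best hs) => h; rewrite ?h ?(negbTE h).
  rewrite (_ : (3 * m + 3)%N = (3 * m + 2).+1); last lia.
  apply: runs_rset_seq.
  apply: runs_le (@runs_map _ _ _ f 2 _ (fun r => rmem s 3 r / Y) _ _ _) _ _.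
  - by rewrite /= (sm_m hs).
  - by move=> r s' rm h' [_ hr] /=; rewrite h' !hr //= hY.
  - exact: leqnn.
  move=> s' /= [[hi hr] hz]; split; last by rewrite hr.
  split; try by rewrite ?hi ?hr //; case: hs.
  - by rewrite hr //= hY (sm_Y0 hs).
  - by rewrite -(sm_y hs); apply: read_vec_ext => j; rewrite hr.
  - by rewrite -(sm_x hs); apply: read_vec_ext => j; rewrite hr.
  - by rewrite hz; apply/rowP => r; rewrite !mxE -(sm_y hs) mxE.
apply: (@runs_weak _ _ _ _ 1); first lia.
by apply: runs_skip.
Qed.

Lemma runs_end_phase delta l e Phi C rem w W Y0 best y x z Y s :
  stage_mem n delta l e Phi C rem w W Y0 best y x z s -> rmem s 0 6 = Y ->
  runs f end_phase s (3 * m + 10) 0 (fun s' =>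
    if (1 + e) * Y0 < Y then
      stage_mem n delta l e Phi 0 (w / 2) (w / 2) W Y best y x z s'
    else if (C < n)%N then stage_mem n delta l e Phi C rem w W Y0 best y x z s'
    else stage_mem n delta l e Phi 0 w w (W + w) Y
      (if best * Y0 < Y then Y / Y0 else best) y x
      (if best * Y0 < Y then \row_r (y 0 r / Y) else z) s').
Proof.
move=> hs hY; rewrite (_ : (3 * m + 10)%N = (3 * m + 9).+1); last lia.
apply: runs_if => /=; rewrite hY (sm_Y0 hs) (sm_e hs) => h; rewrite ?h ?(negbTE h).
  apply: (@runs_weak _ _ _ _ 4); first lia.
  apply: runs_rset_seq; apply: runs_rset_seq; apply: runs_iset_seq; apply: runs_rset.
  by split=> //=; rewrite ?(sm_w hs) //; case: hs.
rewrite (_ : (3 * m + 9)%N = (3 * m + 8).+1); last lia.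
apply: runs_if => /=; rewrite (sm_C hs) (sm_n hs) => hC; rewrite ?hC ?(negbTE hC).
  apply: (@runs_weak _ _ _ _ 1); first lia.
  by apply: runs_skip.
rewrite (_ : (3 * m + 8)%N = (3 * m + 4 + 4)%N); last lia.
apply: runs_bind (runs_record_dual hs hY) _ => s' [hs' hY'].
apply: runs_rset_seq; apply: runs_rset_seq; apply: runs_iset_seq; apply: runs_rset.
by split=> //=; rewrite ?(sm_w hs') ?(sm_W hs') //; case: hs'.
Qed.

Lemma runs_stage_init delta l e Phi w s :
  ivar s 0 = n -> ivar s 1 = m -> rmem s 0 0 = delta -> rmem s 0 11 = l ->
  rmem s 0 1 = e -> rmem s 0 2 = Phi -> rmem s 0 3 = w ->
  runs f stage_init_cmd s (9 * m + 12) 0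
    (stage_mem n delta l e Phi 0 w w 0 m%:R 0 (const_mx 1) 0 (read_vec m s 2)).
Proof.
move=> hn hm hd hl he hPhi hw; eapply runs_weak; last first.
  eapply runs_bind; first by apply: (@runs_map _ _ _ f 3 _ (fun=> 1)).
  move=> s1 /= [[i1 r1] v1].
  eapply runs_bind.
    by apply: (@runs_map _ _ _ f 1 _ (fun=> 0)); first by rewrite i1.
  move=> s2 /= [[i2 r2] v2].
  eapply runs_bind; first by apply: (@runs_Sum _ _ _ f 3 6); rewrite ?i2 ?i1.
  move=> s3 /= [[i3 r3] Y3].
  do 4![apply: runs_rset_seq]; apply: runs_iset.
  have y2 : read_vec m s2 3 = const_mx 1.
    transitivity (read_vec m s1 3); last by rewrite v1; apply/rowP => r; rewrite !mxE.
    by apply: read_vec_ext => j; rewrite r2.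
  have rE k : k != 6%N -> rmem s3 0 k = rmem s 0 k.
    by move=> k6; rewrite r3 ?(negbTE k6) // r2 // r1.
  split; try by rewrite /= ?i3 ?i2 ?i1 ?rE.
  - by rewrite /= Y3 y2 sum_row1.
  - by rewrite -y2; apply: read_vec_ext => j /=; rewrite r3.
  - transitivity (read_vec m s2 1); last by rewrite v2; apply/rowP => r; rewrite !mxE.
    by apply: read_vec_ext => j /=; rewrite r3.
  - by apply: read_vec_ext => j /=; rewrite r3 // r2 // r1.
lia.
Qed.

Section Loop.
Variables (X : 'I_n -> set 'rV[R]_m) (sigma : R).
Hypothesis hX : rs_instance X.
Hypothesis hf : block_solver sigma X f.
Hypothesis hsigma : 1 <= sigma.
Hypothesis m0 : (0 < m)%N.
Hypothesis n0 : (0 < n)%N.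
Variables delta l e Phi w0 : R.
Hypothesis e01 : 0 < e <= 1.
Hypothesis w00 : 0 < w0.
Hypothesis Phi0 : 0 <= Phi.

Let lam := lambda_star X.

Definition loop_inv (j : nat) s := exists C rem w W Y0 best y x z,
  stage_inv X f sigma e Phi w0 j C rem w W Y0 best y x z /\
  stage_mem n delta l e Phi C rem w W Y0 best y x z s.

Lemma loop_inv_step j s : loop_inv j s ->
  beval s (BRLt (sc 4) (RMul (sc 2) (sc 3))) ->
  runs f (Seq oracle_step end_phase) s (16 * m + 25) 1 (loop_inv j.+1).
Proof.
move=> [C [rem [w [W [Y0 [best [y [x [z [[N [A [ys [Gs [G [J hst]]]]]] hs]]]]]]]]]].
rewrite /= (sm_W hs) (sm_Phi hs) (sm_w hs) => hrun.
have hph := si_ph hst.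
have y0 : nonneg_vec y by move=> r; have := ph_ys hph r; lra.
pose Co := Ordinal (si_C hst).
rewrite (_ : (16 * m + 25)%N = ((13 * m + 15) + (3 * m + 10))%N); last lia.
apply: (@runs_seq _ _ _ _ _ _ _ _ _ 1 0 _ _
  (@runs_oracle_step _ _ _ f delta l e Phi Co rem w W Y0 best y x z y0 s hs)).
move=> s1 [mx [hmx hmx' hs1 hY]].
apply: runs_le (runs_end_phase hs1 hY) (leqnn _) _ => s2.
have /andP[rem0 remw] := ph_rem hph.
have mx0 : 1 < rem * mx -> 0 < mx.
  by move=> h; rewrite -(pmulr_rgt0 _ rem0); exact: lt_trans h.
have b0 : nonneg_vec (f Co y) by have [/(X_ge0 hX)] := hf Co y0.
have hxi : 0 < step_size rem mx.
  rewrite /step_size; case: (ltP 1 (rem * mx)) => // h.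
  by rewrite divr_gt0 // mx0.
have hxib r : step_size rem mx * f Co y 0 r <= 1.
  rewrite /step_size; case: (ltP 1 (rem * mx)) => h.
    by rewrite mul1r mulrC ler_pdivrMr ?mx0 // mul1r.
  by apply: le_trans h; rewrite ler_pM2l.
have hnext :
  [/\ next_C Co rem mx = Co, next_rem rem w mx = rem - step_size rem mx,
      0 < next_rem rem w mx & exists r, step_size rem mx * f Co y 0 r = 1] \/
  [/\ next_C Co rem mx = Co.+1, next_rem rem w mx = w & step_size rem mx = rem].
  rewrite /next_C /next_rem /step_size; case: (ltP 1 (rem * mx)) => h; [left|right] => //.
  have {}mx0 := mx0 h.
  split=> //; first by rewrite subr_gt0 ltr_pdivrMr.
  (* Being positive, the maximum is attained; that resource receives load exactly 1. *)
  case: hmx' => [E|[r E]]; first by move: mx0; rewrite E ltxx.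
  by exists r; rewrite -E mul1r mulVf // gt_eqF.
have hst' : stage_inv_at X f sigma e Phi w0 N A ys Gs G J j Co rem w W Y0 best y x z := hst.
case: ltP => hab.
  move=> hs2; do 9!eexists; split; last exact: hs2.
  exact: (stage_abort hX hf hsigma m0 n0 e01 hst' hxi hxib hnext hab).
case: ltnP => hC hs2; do 9!eexists; split; try exact: hs2.
  exact: (stage_continue hX hf e01 hst' hrun hxi hxib hnext hab hC).
exact: (stage_complete hX hf hsigma m0 n0 e01 hst' hrun hxi hxib hnext hab hC).
Qed.

(** Only for termination: [N <= Phi + 1], and [A < 2 ^ A < 4 * sigma * lam * w0], bound the phases
    independently of the state. *)
Lemma loop_inv_bound : exists B, forall j s, loop_inv j s -> (j <= B)%N.
Proof.
have lam0 : 0 <= lam by exact: (lambda_ge0 hX).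
have sl0 : 0 <= 4 * sigma * lam * w0.
  by rewrite !mulr_ge0 // ?ltW //; apply: lt_le_trans hsigma.
have e0 : 0 < e by case/andP: e01.
pose P := Phi + 1 + 4 * sigma * lam * w0.
have P0 : 0 <= P by rewrite !addr_ge0.
have ln0 : 0 <= ln m%:R :> R by rewrite ln_ge0 // ler1n.
pose B := n%:R * (P + 1) + m%:R * ((1 + e) / e * (ln m%:R + e * (2 * P + 1))).
exists (Num.bound B) => j s.
move=> [C [rem [w [W [Y0 [best [y [x [z [[N [A [ys [Gs [G [J hst]]]]]] _]]]]]]]]]].
have hP : (N + A)%:R <= P.
  rewrite natrD /P lerD ?(si_N hst) //.
  case: (posnP A) => [->//|/(si_A hst)] h; apply: le_trans (ltW h).
  by rewrite -natrX ler_nat ltnW // ltn_expl.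
have e1 : 0 < (1 + e) / e by rewrite divr_gt0 // addr_gt0.
have hB : j%:R <= B.
  apply: le_trans (stage_count_le m0 e01 hst) _; apply: lerD.
    by rewrite ler_wpM2l // lerD2r.
  by rewrite ler_wpM2l // ler_pM2l // lerD2l ler_pM2l // lerD2r ler_pM2l.
have B0 : 0 <= B by apply: le_trans hB.
by rewrite -(ler_nat R); apply: le_trans hB _; apply: ltW; exact: archi_boundP.
Qed.

Lemma runs_stage s :
  ivar s 0 = n -> ivar s 1 = m -> rmem s 0 0 = delta -> rmem s 0 11 = l ->
  rmem s 0 1 = e -> rmem s 0 2 = Phi -> rmem s 0 3 = w0 ->
  exists j, runs f (Seq stage_init_cmd stage_loop) s
    ((16 * m + 26) * j + 9 * m + 13) j
    (fun s' => exists C rem w W Y0 best y x z,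
      [/\ stage_inv X f sigma e Phi w0 j C rem w W Y0 best y x z,
          stage_mem n delta l e Phi C rem w W Y0 best y x z s'
        & ~~ (W < Phi * w)]).
Proof.
move=> hn hm hd hl he hPhi hw.
have [s1 [t1 [h1 ht1 hs1]]] := runs_stage_init hn hm hd hl he hPhi hw.
have [B hB] := loop_inv_bound.
have I0 : loop_inv 0 s1.
  do 9!eexists; split; last exact: hs1.
  exact: (stage_init f sigma hX n0 e01 w00).
have [j [s2 [t2 [h2 ht2 [hI hb]]]]] := runs_while loop_inv_step hB I0.
rewrite mul1n in h2.
exists j, s2, (t1 + t2)%N; split; first exact: ExecSeq h1 h2.
  lia.
move: hI => [C [rem [w [W [Y0 [best [y [x [z [hst hs]]]]]]]]]].
exists C, rem, w, W, Y0, best, y, x, z; split=> //.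
by move: hb; rewrite /= (sm_W hs) (sm_Phi hs) (sm_w hs).
Qed.

End Loop.
End StageProgram.

(** * Computing the logarithm, the first loads and the parameters of the stages *)

Definition log_cmd : cmd :=
  Seq (ISet 4 (ICst 1)) (Seq (SSet 11 (RCst 1))
    (While (BILt (IVar 4) (IVar 1))
      (Seq (ISet 4 (IAdd (IVar 4) (IVar 4))) (SSet 11 (RAdd (sc 11) (RCst 1)))))).

(** One call per customer at unit prices; the sum [D] of the resulting loads satisfies [lambda_star
    <= D <= sigma * lambda_star * m]. *)
Definition first_loads_cmd : cmd :=
  Seq (For (RSet 3 (IVar 3) (RCst 1)))
    (While (BILt (IVar 2) (IVar 0))
      (Seq (Call (IVar 2) 3 4)
        (Seq (For (RSet 1 (IVar 3) (RAdd (ent 1) (ent 4))))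
          (ISet 2 (IAdd (IVar 2) (ICst 1)))))).

Definition stage_cmd : cmd := Seq stage_init_cmd stage_loop.

(* At the end of the first stage lambda_star w <= load_factor s and
   1 <= 4 s lambda_star w. *)
Definition load_factor (s : nat) : nat := 26 + 8 * s.
Definition phase_factor (s : nat) : nat := 16 * s * s * load_factor s.

(** The initial weight is [s * m / D], which puts [lambda_star * w] between 1 and [s * m]. The real
    number [m] is obtained as the sum of the unit prices, since the expressions do not convert
    registers to reals. *)
Definition setup1 (s : nat) : cmd :=
  Seq (Sum 3 6) (Seq (SSet 3 (RDiv (RMul (RCst s) (sc 6)) (sc 12)))
    (Seq (SSet 1 (RCst 1)) (SSet 2 (sc 11)))).

(** The divisor [4 * s * load_factor s] brings [s * lambda_star * w] down to at most [1 / 4];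
    [phase_factor s] is this divisor times [4 * s], so that [phase_factor s * (lambda_star * w)] is
    at least 1. *)
Definition setup2 (s : nat) : cmd :=
  Seq (SSet 3 (RDiv (sc 3) (RCst (4 * s * load_factor s))))
    (Seq (SSet 1 (RDiv (sc 0) (RCst 8)))
      (SSet 2 (RDiv (RMul (RCst (phase_factor s)) (sc 11)) (RMul (sc 1) (sc 1))))).

Definition normalise_cmd : cmd := For (RSet 1 (IVar 3) (RDiv (ent 1) (sc 4))).

Definition main_cmd (s : nat) : cmd :=
  Seq (setup1 s) (Seq stage_cmd (Seq (setup2 s) (Seq stage_cmd normalise_cmd))).

(** If the first loads sum to 0, they already solve the problem, and the first unit vector serves as
    dual solution. *)
Definition program (s : nat) : cmd :=
  Seq (Seq log_cmd (Seq first_loads_cmd (Sum 1 12)))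
    (If (BRLt (RCst 0) (sc 12)) (main_cmd s) (RSet 2 (ICst 0) (RCst 1))).

Section Prep.
Variables (R : realType) (n m : nat) (f : 'I_n -> 'rV[R]_m -> 'rV[R]_m).
Implicit Types (s : state R).

Definition first_load : 'rV[R]_m := \sum_C f C (const_mx 1).

(** Here [k] is the logarithm of [m] to base 2, rounded up. The stored value [k + 1] is at least 1
    also for [m = 1]. *)
Lemma runs_log s : ivar s 1 = m -> (0 < m)%N ->
  runs f log_cmd s (3 * m + 3) 0 (fun s' =>
    [/\ forall v, v != 4%N -> ivar s' v = ivar s v,
        forall a j, ~~ ((a == 0%N) && (j == 11%N)) -> rmem s' a j = rmem s a j
      & exists2 k : nat, rmem s' 0 11 = k.+1%:R &
          (m <= 2 ^ k)%N /\ ((0 < k)%N -> (2 ^ k.-1 < m)%N)]).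
Proof.
move=> hm m0.
rewrite (_ : (3 * m + 3)%N = (3 * m + 1).+2); last lia.
apply: runs_iset_seq; apply: runs_rset_seq; set s0 := set_rmem _ _ _ _.
pose I j s1 := [/\ forall v, v != 4%N -> ivar s1 v = ivar s v,
  forall a i, ~~ ((a == 0%N) && (i == 11%N)) -> rmem s1 a i = rmem s a i,
  ivar s1 4 = (2 ^ j)%N, rmem s1 0 11 = j.+1%:R
  & (0 < j)%N -> (2 ^ j.-1 < m)%N].
have I0 : I 0%N s0.
  split=> //= [v /negbTE -> //|a i /negbTE /= ->//].
have bound j s1 : I j s1 -> (j <= m)%N.
  case: j => // j [_ _ _ _ /(_ isT) /=]; apply: leq_trans.
  by have := ltn_expl j (ltnSn 1); lia.
have [|j [s' [u [h hu [[h1 h2 h3 h4 h5] hb]]]]] :=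
    @runs_while _ _ _ f (BILt (IVar 4) (IVar 1)) (Seq (ISet 4 (IAdd (IVar 4) (IVar 4)))
      (SSet 11 (RAdd (sc 11) (RCst 1)))) 0 2 m I s0 _ bound I0.
  move=> j s1 [h1 h2 h3 h4 h5] /=; rewrite h3 h1 // hm => hlt.
  apply: runs_iset_seq; apply: runs_rset; split=> //=.
  - by move=> v hv; rewrite (negbTE hv) h1.
  - by move=> a i hi; rewrite (negbTE hi) h2.
  - by rewrite h3 expnS; lia.
  - by rewrite h4 natr1.
have hj := bound j s' (And5 h1 h2 h3 h4 h5).
exists s', u; split=> //; first lia.
split=> //; exists j => //; split=> //.
by move: hb; rewrite /= h3 h1 // hm -leqNgt.
Qed.

Lemma runs_first_loads s : ivar s 0 = n -> ivar s 1 = m -> ivar s 2 = 0%N ->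
  read_vec m s 1 = 0 ->
  runs f first_loads_cmd s ((3 * m + 5) * n + 3 * m + 3) n (fun s' =>
    [/\ forall v, v != 2%N -> v != 3%N -> ivar s' v = ivar s v,
        forall a j, a != 1%N -> a != 3%N -> a != 4%N -> rmem s' a j = rmem s a j,
        read_vec m s' 1 = first_load
      & read_vec m s' 3 = const_mx 1]).
Proof.
move=> hn hm h2 hx.
have [s1 [t1 [e1 ht1 [[i1 r1] v1]]]] :
  runs f (For (RSet 3 (IVar 3) (RCst 1))) s (3 * m + 2) 0
    (fun s' => changed (fun b _ => b == 3%N) s s' /\ read_vec m s' 3 = \row_(r < m) 1).
  by apply: (@runs_map _ _ _ f 3 _ (fun=> 1)).
pose I j s' := [/\ (j <= n)%N /\ ivar s' 2 = j,
  forall v, v != 2%N -> v != 3%N -> ivar s' v = ivar s v,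
  forall a i, a != 1%N -> a != 3%N -> a != 4%N -> rmem s' a i = rmem s a i,
  read_vec m s' 1 = \sum_(C < n | (C < j)%N) f C (const_mx 1)
  & read_vec m s' 3 = const_mx 1].
have I0 : I 0%N s1.
  split; rewrite ?i1 //.
  - by move=> v hv hv'; rewrite i1.
  - by move=> a i ha ha' ha''; rewrite r1.
  - rewrite big_pred0 // -hx; apply: read_vec_ext => j; by rewrite r1.
  - by rewrite v1; apply/rowP => r; rewrite !mxE.
have bound j s' : I j s' -> (j <= n)%N by case=> [[]].
have [|j [s' [u [h hu [[[hj hC] k1 k2 k3 k4] hb]]]]] :=
    @runs_while _ _ _ f (BILt (IVar 2) (IVar 0)) (Seq (Call (IVar 2) 3 4)
        (Seq (For (RSet 1 (IVar 3) (RAdd (ent 1) (ent 4))))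
          (ISet 2 (IAdd (IVar 2) (ICst 1))))) 1 (3 * m + 4) n I s1 _ bound I0.
  move=> j s2 [[hj hC] k1 k2 k3 k4] /=; rewrite hC k1 // hn => hlt.
  rewrite (_ : (3 * m + 4)%N = (3 * m + 2 + 1).+1); last lia.
  apply: (runs_call_seq (C := Ordinal hlt)) => //.
    by rewrite k4 => r; rewrite mxE.
  rewrite k4; set s3 := write_vec _ _ _.
  have s3r a i : a != 4%N -> rmem s3 a i = rmem s2 a i by move=> /negbTE /= ->.
  apply: (@runs_bind _ _ _ f _ _ _ (3 * m + 2) 1).
    apply: (@runs_map _ _ _ f 1 _ (fun r => rmem s2 1 r + rmem s3 4 r)).
      by rewrite /= k1.
    move=> r s' rm h [_ hr] /=; rewrite h !hr //= ?ltnn // ?andbF //.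
  move=> s4 /= [[i4 r4] v4]; apply: runs_iset; split.
  - by rewrite /= i4 //= hC addn1.
  - by move=> v hv hv'; rewrite /= (negbTE hv) i4 //= k1.
  - by move=> a i ha ha' ha''; rewrite /= r4 // s3r // k2.
  - transitivity (read_vec m s4 1); first exact: read_vec_ext.
    have -> : \sum_(C < n | (C < j.+1)%N) f C (const_mx 1)
        = \sum_(C < n | (C < j)%N) f C (const_mx 1) + f (Ordinal hlt) (const_mx 1).
      rewrite (bigD1 (Ordinal hlt)) //= addrC; congr (_ + _).
      by apply: eq_bigl => C; rewrite -val_eqE /=; lia.
    rewrite v4 -k3; apply/rowP => r; rewrite !mxE; congr (_ + _).
    by rewrite -[in RHS](read_write s2 4 (f (Ordinal hlt) (const_mx 1))) mxE.
  - rewrite -k4; apply: read_vec_ext => i; by rewrite /= r4.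
have jn : j = n by move: hb; rewrite /= hC k1 // hn; lia.
rewrite jn mul1n in h hu.
exists s', (t1 + u)%N; split.
- by rewrite -[X in exec _ _ _ _ _ X]add0n; exact: ExecSeq e1 h.
- lia.
- split=> //; rewrite k3 jn; apply: eq_bigl => C; by rewrite ltn_ord.
Qed.

End Prep.

(** * Analysis of the two stages *)

Section Assembly.
Variables (R : realType) (n m : nat).
Variables (X : 'I_n -> set 'rV[R]_m) (f : 'I_n -> 'rV[R]_m -> 'rV[R]_m).
Variable sigma : R.
Hypothesis hX : rs_instance X.
Hypothesis hf : block_solver sigma X f.
Hypothesis hsigma : 1 <= sigma.
Hypothesis m0 : (0 < m)%N.

Let lam := lambda_star X.
Let lam0 : 0 <= lam. Proof. exact: (lambda_ge0 hX). Qed.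
Let sigma0 : 0 < sigma. Proof. exact: lt_le_trans hsigma. Qed.
Let v := first_load f.

Let ones_ge0 : nonneg_vec (const_mx 1 : 'rV[R]_m).
Proof. by move=> r; rewrite mxE. Qed.

Lemma first_load_mink : minkowski_sum X v.
Proof. by exists (fun C => f C (const_mx 1)) => // C; have [] := hf C ones_ge0. Qed.

Lemma lambda_le_first_load : lam <= \sum_r v 0 r.
Proof.
have v0 := mink_ge0 hX first_load_mink.
apply: (lambda_le_coord hX first_load_mink); first exact: sumr_ge0.
by move=> r; rewrite (bigD1 r) //= lerDl sumr_ge0.
Qed.

(** At unit prices the cost of an answer is the sum of its entries, and weak duality bounds the
    block optima by [lam * m]. *)
Lemma first_load_le : \sum_r v 0 r <= sigma * (lam * m%:R).
Proof.
have -> : \sum_r v 0 r = \sum_C dotr (const_mx 1) (f C (const_mx 1)).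
  rewrite -dotr_suml /dotr; apply: eq_bigr => r _; by rewrite [const_mx _ _ _]mxE mul1r.
apply: (@le_trans _ _ (sigma * \sum_C opt X C (const_mx 1))).
  rewrite mulr_sumr; apply: ler_sum => C _; by have [] := hf C ones_ge0.
rewrite ler_pM2l // -(sum_row1 R m); apply: (sum_opt_le hX ones_ge0).
by exists (Ordinal m0); rewrite mxE.
Qed.

(** * First stage: estimating [1 / lambda_star] up to a constant factor *)

Section Estimate.
Variables (s L : nat) (w0 : R).
Hypothesis hs : sigma <= s%:R.
Hypothesis L0 : (0 < L)%N.
Hypothesis hL : (m <= 2 ^ L)%N.
Hypothesis w00 : 0 < w0.
Hypothesis lw1 : 1 <= lam * w0.
Hypothesis lw2 : lam * w0 <= s%:R * m%:R.
Variables (j C : nat) (rem w W Y0 best : R) (y x z : 'rV[R]_m).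
Variables (N A : nat) (ys : 'rV[R]_m) (Gs G : 'I_n -> 'rV[R]_m) (J : 'rV[R]_m).
Hypothesis hst : stage_inv_at X f sigma 1 L%:R w0 N A ys Gs G J j C rem w W Y0 best y x z.
Hypothesis hstop : ~~ (W < L%:R * w).

Let s1 : 1 <= s%:R :> R. Proof. exact: le_trans hs. Qed.

Let w_gt0 : 0 < w. Proof. by have /andP[h1 h2] := ph_rem (si_ph hst); exact: lt_le_trans h2. Qed.

(** Every abort halves [w], and [2 ^ A < 4 * sigma * lam * w0 <= 4 * s * s * m]. *)
Lemma estimate_aborts : (A <= 2 + 2 * s + L)%N.
Proof.
case: (posnP A) => [-> //|/(si_A hst) h].
have h2 : 2 ^+ A < (4 * s * s * m)%:R :> R.
  apply: lt_le_trans h _; rewrite !natrM -!mulrA ler_pM2l //.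
  by rewrite ler_pM ?(ltW sigma0) ?mulr_ge0 ?(ltW w00).
rewrite -natrX ltr_nat in h2.
have h3 : (4 * s * s * m <= 2 ^ (2 + 2 * s + L))%N.
  rewrite (_ : (2 + 2 * s + L)%N = (2 + s + s + L)%N); last lia.
  by rewrite !expnD !leq_mul // ltnW // ltn_expl.
by rewrite ltnW // -(ltn_exp2l _ _ (ltnSn 1)); exact: leq_trans h2 h3.
Qed.

Let hP : (N + A <= (5 + 2 * s) * L)%N.
Proof.
have hN : (N <= L.+1)%N by rewrite -(ler_nat R) -natr1; exact: si_N hst.
have := estimate_aborts; nia.
Qed.

Let hln : ln m%:R <= L%:R :> R.
Proof.
rewrite -ler_expR lnK ?posrE ?ltr0n //; exact: nat_le_expR.
Qed.

Let load_bound : (1 + 1) / 1 * (ln m%:R + 1 * (2 * (N + A)%:R + 1))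
  <= (L * (24 + 8 * s))%:R :> R.
Proof.
have h1 : (2 * (N + A) + 1 <= (11 + 4 * s) * L)%N by move: hP L0; nia.
rewrite divr1 mul1r.
apply: (@le_trans _ _ ((1 + 1) * (L%:R + ((11 + 4 * s) * L)%:R))).
  rewrite ler_pM2l // lerD //; apply: le_trans (_ : (2 * (N + A) + 1)%:R <= _).
    by rewrite [leRHS]natrD natrM.
  by rewrite ler_nat.
rewrite -natrD -[1 + 1]/2%:R -natrM ler_nat; nia.
Qed.

(** Only [O(L)] phases are run, so all loads are [O(L)]; as [lam * W] is at most the largest load
    and [W >= L * w] at the stop, the factor [L] cancels. *)
Lemma estimate_upper : lam * w <= (load_factor s)%:R.
Proof.
have hx r : x 0 r <= (L * load_factor s)%:R.
  apply: le_trans (stage_load_le m0 _ hst r) _; first by rewrite ltr01 lexx.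
  apply: le_trans load_bound _; rewrite ler_nat /load_factor; nia.
have hB := lambda_mul_le hX hst (ler0n _ _) hx.
have LR : 0 < L%:R :> R by rewrite ltr0n.
rewrite -(ler_pM2l LR) -natrM; apply: le_trans hB.
by rewrite mulrCA ler_wpM2l // leNgt.
Qed.

(** Without aborts [w] is the initial weight; otherwise the last abort certified that twice the
    present weight was too large. *)
Lemma estimate_lower : 1 <= 4 * s%:R * (lam * w).
Proof.
have p2 : 0 < 2 ^+ A :> R by rewrite exprn_gt0.
have wE : w * 2 ^+ A = w0 by rewrite (si_w hst) divfK // gt_eqF.
case: (posnP A) => [A0|/(si_A hst) h].
  move: wE; rewrite A0 expr0 mulr1 => ->.
  apply: le_trans lw1 _; rewrite ler_peMl ?mulr_ge0 ?(ltW w00) //.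
  by move: s1; lra.
have h' : 1 < 4 * (sigma * (lam * w)).
  rewrite -(ltr_pM2r p2) mul1r; apply: lt_le_trans h _.
  by rewrite -wE le_eqVlt; apply/orP; left; apply/eqP; ring.
apply: le_trans (ltW h') _; rewrite -mulrA ler_pM2l // ler_wpM2r //.
by rewrite mulr_ge0 // ltW.
Qed.

Lemma estimate_count : j%:R <= ((n + m) * L * load_factor s)%:R :> R.
Proof.
apply: le_trans (stage_count_le m0 _ hst) _; first by rewrite ltr01 lexx.
apply: (@le_trans _ _ (n%:R * (L * load_factor s)%:R + m%:R * (L * load_factor s)%:R)).
  apply: lerD; rewrite ler_wpM2l //.
    rewrite natr1 ler_nat /load_factor; move: hP L0; nia.
  apply: le_trans load_bound _; rewrite ler_nat /load_factor; nia.
by rewrite -mulrDl -natrD -natrM mulnA.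
Qed.

End Estimate.

(** * Second stage: the number of oracle calls *)

Section Refine.
Variables (s : nat) (c l delta e Phi w0 : R).
Hypothesis hs : sigma <= s%:R.
Hypothesis hd : 0 < delta <= 1.
Hypothesis eE : e = delta / 8.
Hypothesis c1 : 1 <= c.
Hypothesis l1 : 1 <= l.
Hypothesis hl : ln m%:R <= l.
Hypothesis PhiE : Phi = c * l / e ^+ 2.
Hypothesis w00 : 0 < w0.
Hypothesis hw1 : s%:R * (lam * w0) <= 4^-1.
Variables (j C : nat) (rem w W Y0 best : R) (y x z : 'rV[R]_m).
Variables (N A : nat) (ys : 'rV[R]_m) (Gs G : 'I_n -> 'rV[R]_m) (J : 'rV[R]_m).
Hypothesis hst : stage_inv_at X f sigma e Phi w0 N A ys Gs G J j C rem w W Y0 best y x z.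

(** Without aborts all terms are at most [12 * Phi] per customer or resource, and [12 * 64 = 768]
    because [e = delta / 8]. *)
Lemma refine_count : j%:R <= (n + m)%:R * l * (768 * c) / delta ^+ 2.
Proof.
have [/andP[d0 d1] hc hll hln] := And4 hd c1 l1 hl.
have e0 : 0 < e by rewrite eE; lra.
have e1 : e <= 1 by rewrite eE; lra.
have e01 : 0 < e <= 1 by rewrite e0.
have A0 : A = 0%N by exact: (exit_no_abort hX w00 hs hw1 hst).
have hN := si_N hst.
have e2 : 0 < e ^+ 2 by rewrite exprn_gt0.
have c0 : 0 < c by lra.
have l0 : 0 < l by lra.
have le_Phi : l / e <= Phi.
  rewrite PhiE ler_pdivrMr // expr2 invfM mulrA divfK ?gt_eqF //.
  rewrite ler_pdivlMr //; apply: (@le_trans _ _ (l * 1)); first by rewrite ler_pM2l.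
  by rewrite mulr1 ler_peMl // ltW.
have Phi1 : 1 <= Phi.
  by apply: le_trans le_Phi; rewrite ler_pdivlMr // mul1r; apply: le_trans l1.
apply: le_trans (stage_count_le m0 e01 hst) _; rewrite A0 addn0.
have -> : (n + m)%:R * l * (768 * c) / delta ^+ 2 = (n + m)%:R * (12 * Phi).
  by rewrite PhiE eE; field; rewrite gt_eqF.
rewrite [(n + m)%:R]natrD [leRHS]mulrDl; apply: lerD; rewrite ler_wpM2l //; first lra.
have -> : (1 + e) / e * (ln m%:R + e * (2 * N%:R + 1))
    = (1 + e) * (ln m%:R / e) + (1 + e) * (2 * N%:R + 1).
  by field; rewrite gt_eqF.
have h1 : (1 + e) * (ln m%:R / e) <= 2 * Phi.
  rewrite ler_pM //; try lra.
  - by rewrite divr_ge0 ?(ltW e0) // ln_ge0 // ler1n.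
  - by apply: le_trans le_Phi; rewrite ler_pM2r // invr_gt0.
have h2 : (1 + e) * (2 * N%:R + 1) <= 2 * (2 * Phi + 3).
  have NR : 0 <= N%:R :> R by [].
  by rewrite ler_pM //; lra.
lra.
Qed.

End Refine.
End Assembly.

(** The summands account for the first loads, the first stage and the second stage; the 6 converts
    the integer logarithm to [ln]. *)
Definition call_constant (s : nat) : nat := 6 * (1 + load_factor s + 768 * phase_factor s).

(** * Assembling the complete run *)

Section Correctness.
Variables (R : realType) (n m : nat).
Variables (X : 'I_n -> set 'rV[R]_m) (f : 'I_n -> 'rV[R]_m -> 'rV[R]_m).
Variables (sigma delta : R) (s : nat).
Hypothesis hX : rs_instance X.
Hypothesis hf : block_solver sigma X f.
Hypothesis hsigma : 1 <= sigma.
Hypothesis hs : sigma <= s%:R.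
Hypothesis m0 : (0 < m)%N.
Hypothesis hd : 0 < delta <= 1.

Let lam := lambda_star X.
Let lam0 : 0 <= lam. Proof. exact: (lambda_ge0 hX). Qed.
Let sigma0 : 0 < sigma. Proof. exact: lt_le_trans hsigma. Qed.
Let s1 : 1 <= s%:R :> R. Proof. exact: le_trans hs. Qed.
Let s_gt0 : (0 < s)%N. Proof. by rewrite -(ler_nat R). Qed.
Let v := first_load f.

Definition good (x z : 'rV[R]_m) : Prop :=
  [/\ minkowski_sum X x, simplex z,
      `|x| <= (1 + delta) * sigma * lam,
      min_dot (minkowski_sum X) z >= (1 - delta) * (lam / sigma)
    & forall (S : {set 'I_m}) (mu : R), 0 <= mu -> local_weak_duality f S mu ->
        \big[Num.max/0]_(r in S) x 0 r <= mu + delta * Num.max lam mu].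

Lemma good_zero : \sum_r v 0 r <= 0 ->
  good v (\row_r ((r : nat) == 0%N)%:R).
Proof.
move=> D0.
have v0 := mink_ge0 hX (first_load_mink hf).
have lamE : lam = 0.
  apply/eqP; rewrite eq_le lam0 andbT.
  exact: le_trans (lambda_le_first_load hX hf) D0.
have vr r : v 0 r = 0.
  apply/eqP; rewrite eq_le v0 andbT; apply: le_trans D0.
  by rewrite (bigD1 r) //= lerDl sumr_ge0.
have vE : v = 0 by apply/rowP => r; rewrite vr mxE.
split.
- exact: (first_load_mink hf).
- split=> [r|]; first by rewrite mxE ler0n lern1 leq_b1.
  rewrite (bigD1 (Ordinal m0)) //= big1 ?addr0 ?mxE ?eqxx ?normr1 // => r.
  by rewrite -val_eqE mxE /= => /negbTE ->; rewrite normr0.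
- by rewrite vE normr0 lamE mulr0.
- rewrite lamE mul0r mulr0.
  have z0 : nonneg_vec (\row_(r < m) ((r : nat) == 0%N)%:R : 'rV[R]_m).
    by move=> r; rewrite mxE.
  apply: le_trans (sum_opt_le_min_dot hX z0).
  by apply: sumr_ge0 => C _; exact: (opt_ge0 hX).
- move=> S mu mu0 _; have /andP[d0 _] := hd.
  have M0 : 0 <= mu + delta * Num.max lam mu.
    by rewrite addr_ge0 // mulr_ge0 ?(ltW d0) // le_max lam0.
  by apply/bigmax_leP; split=> // r _; rewrite vr.
Qed.

(** With [M = maxn m 2], rounding down gives [k - 1 <= 2 * ln M] for positive [k], and
    [ln M >= 1 / 2] absorbs the additive constants. *)
Lemma log_bound k : ((0 < k)%N -> (2 ^ k.-1 < m)%N) ->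
  k.+1%:R <= 6 * ln (maxn m 2)%:R :> R.
Proof.
move=> hk; set M := maxn m 2.
have M0 : (0 < M)%N by rewrite /M; lia.
have h2 : 2^-1 <= ln M%:R :> R.
  apply: le_trans (ln2_ge R) _; rewrite ler_ln ?posrE ?ltr0n //.
  by rewrite ler_nat /M; lia.
case: k hk => [_|k /(_ isT) /= hk]; first by lra.
have h3 : k%:R * 2^-1 <= ln M%:R :> R.
  apply: (@le_trans _ _ (ln (2 ^ k)%:R)).
    by rewrite natrX lnXn // -[leRHS]mulr_natl ler_wpM2l // ln2_ge.
  rewrite ler_ln ?posrE ?ltr0n ?expn_gt0 // ler_nat /M; lia.
rewrite -!natr1; lra.
Qed.

Definition few_calls (q : nat) : Prop :=
  q%:R <= (call_constant s)%:R * ((n + m)%:R / delta ^+ 2 * ln (maxn m 2)%:R).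

Lemma calls_bound (L : nat) (c : R) (q : nat) : c = 768 * (phase_factor s)%:R ->
  L%:R <= 6 * ln (maxn m 2)%:R :> R -> (0 < L)%N ->
  q%:R <= n%:R + ((n + m) * L * load_factor s)%:R
     + (n + m)%:R * L%:R * c / delta ^+ 2 ->
  few_calls q.
Proof.
move=> cE hL L0 hq; have /andP[d0 d1] := hd.
have d2 : 0 < delta ^+ 2 by rewrite exprn_gt0.
have d21 : 1 <= (delta ^+ 2)^-1.
  by rewrite -[leLHS]invr1 lef_pV2 ?posrE // expr_le1 // ltW.
apply: le_trans hq _.
pose T : R := (n + m)%:R * L%:R / delta ^+ 2.
have T0 : 0 <= T by rewrite divr_ge0 ?mulr_ge0 // ltW.
have hT : ((n + m) * L)%:R <= T.
  by rewrite /T natrM ler_peMr // mulr_ge0.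
have h1 : n%:R <= T.
  by apply: le_trans hT; rewrite ler_nat (leq_trans (leq_addr m n)) ?leq_pmulr.
have h2 : ((n + m) * L * load_factor s)%:R <= T * (load_factor s)%:R.
  by rewrite natrM ler_wpM2r.
have -> : (n + m)%:R * L%:R * c / delta ^+ 2 = T * c by rewrite /T; ring.
apply: (@le_trans _ _ (T * (1 + (load_factor s)%:R + c))).
  by rewrite [leRHS]mulrDr lerD2r mulrDr mulr1 lerD.
have -> : (call_constant s)%:R * ((n + m)%:R / delta ^+ 2 * ln (maxn m 2)%:R)
   = (n + m)%:R / delta ^+ 2 * (6 * ln (maxn m 2)%:R)
     * (1 + (load_factor s)%:R + c) :> R.
  by rewrite cE /call_constant natrM natrD [(1 + _)%:R]natrD [(768 * _)%:R]natrM; ring.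
have c0 : 0 <= c by rewrite cE; apply: mulr_ge0; exact: ler0n.
apply: ler_wpM2r; first by apply: addr_ge0 => //; apply: addr_ge0 => //; exact: ler0n.
rewrite /T mulrAC; apply: ler_wpM2l => //.
by rewrite divr_ge0 ?ler0n // ltW.
Qed.

Lemma program_spec : exists (x z : 'rV[R]_m) (t q : nat),
  [/\ computes f (program s) delta x z t q, good x z, few_calls q
    & (t <= 60 * m.+1 * q.+1)%N].
Proof.
have [d0 d1] := andP hd.
have [c cE] : exists c, c = 768 * (phase_factor s)%:R :> R by eexists.
have c_ge0 : 0 <= c by rewrite cE; apply: mulr_ge0; exact: ler0n.
set st0 := init_state n m delta.
have [st1 [t1 [e1 ht1 [i1 r1 [k hk [hk1 hk2]]]]]] :=
  runs_log f (erefl : ivar st0 1 = m) m0.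
have vec1 : read_vec m st1 1 = 0 by apply/rowP => r; rewrite !mxE r1.
have n1 : ivar st1 0 = n by rewrite i1.
have mm1 : ivar st1 1 = m by rewrite i1.
have C1 : ivar st1 2 = 0%N by rewrite i1.
have [st2 [t2 [e2 ht2 [i2 r2 x2 y2]]]] := runs_first_loads f n1 mm1 C1 vec1.
have mm2 : ivar st2 1 = m by rewrite i2.
have [st3 [t3 [e3 ht3 [[i3 r3] D3]]]] := runs_Sum f 12 mm2 (isT : 1%N != 0%N).
have {e1 e2 e3} eprep := ExecSeq e1 (ExecSeq e2 e3).
rewrite add0n addn0 in eprep.
have n3 : ivar st3 0 = n by rewrite i3 // i2.
have mm3 : ivar st3 1 = m by rewrite i3 // i2.
have dl3 : rmem st3 0 0 = delta by rewrite r3 // r2 // r1.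
have l3 : rmem st3 0 11 = k.+1%:R by rewrite r3 // r2.
have y3 : read_vec m st3 3 = const_mx 1.
  by rewrite -y2; apply: read_vec_ext => j; rewrite r3.
have x3 : read_vec m st3 1 = v by rewrite /v -x2; apply: read_vec_ext => j; rewrite r3.
have z3 : forall j, rmem st3 2 j = 0 by move=> j; rewrite r3 // r2 // r1.
rewrite x2 -/v in D3.
have hkl := log_bound hk2.
have ht : (t1 + (t2 + t3) <= (3 * m + 5) * n + 9 * m + 9)%N.
  by clear -ht1 ht2 ht3; lia.
case: (ltP 0 (\sum_r v 0 r)) => hD; last first.
  exists v, (\row_r ((r : nat) == 0%N)%:R), (t1 + (t2 + t3) + 2)%N, (n + 0)%N.
  split; [|exact: good_zero| |by clear -ht; lia].
    exists (set_rmem st3 2 0 1); split.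
    - apply: (ExecSeq eprep); apply: ExecIfFalse; last exact: ExecRSet.
      by rewrite /= D3 -leNgt.
    - by rewrite -x3; apply: read_vec_ext.
    - by apply/rowP => r; rewrite !mxE /= z3; case: eqP.
  rewrite addn0; apply: (calls_bound cE hkl) => //.
  rewrite -addrA lerDl addr_ge0 // divr_ge0 ?exprn_ge0 ?(ltW d0) //.
  by rewrite !mulr_ge0.
(* Without customers the first loads would be an empty sum. *)
have n0 : (0 < n)%N.
  rewrite lt0n; apply/eqP => nE; move: hD; rewrite /v /first_load.
  rewrite big1 ?ltxx // => r _; rewrite big1 ?mxE // => C.
  by have := ltn_ord C; rewrite {2}nE.
have Dle := first_load_le hX hf hsigma m0.
rewrite -/v -/lam in Dle.
have lam_gt0 : 0 < lam.
  rewrite lt_neqAle lam0 andbT eq_sym; apply/eqP => lamE.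
  by move: Dle hD; rewrite -/lam lamE mul0r mulr0; lra.
set D := \sum_r v 0 r in D3 hD Dle.
have lamD : lam <= D := lambda_le_first_load hX hf.
pose w1 := s%:R * m%:R / D.
have sR : 0 < s%:R :> R by rewrite ltr0n.
have mR : 0 < m%:R :> R by rewrite ltr0n.
have w1_gt0 : 0 < w1 by rewrite !mulr_gt0 ?invr_gt0.
have [st4 [t4 [e4 ht4 [[i4 r4] Y4]]]] := runs_Sum f 6 mm3 (isT : 3%N != 0%N).
rewrite y3 sum_row1 in Y4.
have [st5 [t5 [e5 ht5 [n5 mm5 dl5 l5 [ep5 Phi5 w5]]]]] :
  runs f (Seq (SSet 3 (RDiv (RMul (RCst s) (sc 6)) (sc 12)))
    (Seq (SSet 1 (RCst 1)) (SSet 2 (sc 11)))) st4 3 0 (fun st5 =>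
    [/\ ivar st5 0 = n, ivar st5 1 = m, rmem st5 0 0 = delta,
        rmem st5 0 11 = k.+1%:R
      & [/\ rmem st5 0 1 = 1, rmem st5 0 2 = k.+1%:R & rmem st5 0 3 = w1]]).
  apply: runs_rset_seq; apply: runs_rset_seq; apply: runs_rset.
  have D4 : rmem st4 0 12 = \sum_r v 0 r by rewrite r4.
  split; [by rewrite /= i4|by rewrite /= i4|by rewrite /= r4|by rewrite /= r4|].
  by split=> //=; [rewrite r4|rewrite Y4 D4].
have one01 : 0 < (1 : R) <= 1 by rewrite ltr01 lexx.
have [j1 [st6 [t6 [e6 ht6 hpost6]]]] := @runs_stage _ _ _ f X sigma hX hf hsigma m0 n0
  delta k.+1%:R 1 k.+1%:R w1 one01 w1_gt0 (ler0n _ _) st5 n5 mm5 dl5 l5 ep5 Phi5 w5.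
case: hpost6 => C6 [rem6 [w6 [W6 [Y06 [best6 [y6 [x6 [z6 [hst6 hsm6 hstop6]]]]]]]]].
case: hst6 => N6 [A6 [ys6 [Gs6 [G6 [J6 hst6]]]]].
have hL : (m <= 2 ^ k.+1)%N by apply: leq_trans hk1 _; rewrite leq_exp2l.
have lw1 : 1 <= lam * w1.
  rewrite /w1 !mulrA ler_pdivlMr // mul1r; apply: le_trans Dle _.
  rewrite (_ : lam * s%:R * m%:R = s%:R * (lam * m%:R)); last by ring.
  by apply: ler_wpM2r => //; exact: mulr_ge0.
have lw2 : lam * w1 <= s%:R * m%:R.
  rewrite /w1 mulrCA ler_piMr ?mulr_ge0 //.
  by rewrite ler_pdivrMr // mul1r.
have up6 : lam * w6 <= (load_factor s)%:R.
  exact: (estimate_upper hX hsigma m0 hs (ltn0Sn k) hL w1_gt0 lw1 lw2 hst6 hstop6).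
have low6 : 1 <= 4 * s%:R * (lam * w6).
  exact: (estimate_lower hX hsigma hs w1_gt0 lw1 hst6).
have cnt6 : j1%:R <= ((n + m) * k.+1 * load_factor s)%:R :> R.
  exact: (estimate_count hX hsigma m0 hs (ltn0Sn k) hL w1_gt0 lw1 lw2 hst6 hstop6).
have w6_gt0 : 0 < w6.
  by have /andP[h1 h2] := ph_rem (si_ph hst6); exact: lt_le_trans h2.
pose g : R := (load_factor s)%:R.
have g0 : 0 < g by rewrite ltr0n.
pose w2 := w6 / (4 * s * load_factor s)%:R.
have w2E : w2 = w6 / (4 * s%:R * g) by rewrite /w2 !natrM.
have w2_gt0 : 0 < w2 by rewrite w2E divr_gt0 // !mulr_gt0.
pose e := delta / 8.
pose Phi := (phase_factor s)%:R * k.+1%:R / e ^+ 2.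
have e_gt0 : 0 < e by rewrite divr_gt0.
have e01 : 0 < e <= 1.
  by rewrite e_gt0 ler_pdivrMr // mul1r (le_trans d1) // ler1n.
have pfE : (phase_factor s)%:R = 16 * s%:R * s%:R * g :> R by rewrite /phase_factor !natrM.
have c1 : 1 <= (phase_factor s)%:R :> R.
  by rewrite ler1n /phase_factor !muln_gt0 s_gt0.
have hw1 : s%:R * (lam * w2) <= 4^-1.
  have -> : s%:R * (lam * w2) = lam * w6 / (4 * g).
    by rewrite w2E; field; rewrite !gt_eqF.
  by rewrite ler_pdivrMr ?mulr_gt0 // mulrA mulVf // mul1r.
have hw2 : 1 <= (phase_factor s)%:R * (lam * w2).
  have -> : (phase_factor s)%:R * (lam * w2) = 4 * s%:R * (lam * w6).
    by rewrite w2E pfE; field; rewrite !gt_eqF.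
  exact: low6.
have Phi0 : 0 <= Phi.
  apply: divr_ge0; first by apply: mulr_ge0; exact: ler0n.
  by rewrite exprn_ge0 // ltW.
have [st7 [t7 [e7 ht7 [n7 mm7 dl7 l7 [ep7 Phi7 w7]]]]] :
  runs f (setup2 s) st6 3 0 (fun st7 =>
    [/\ ivar st7 0 = n, ivar st7 1 = m, rmem st7 0 0 = delta,
        rmem st7 0 11 = k.+1%:R
      & [/\ rmem st7 0 1 = e, rmem st7 0 2 = Phi & rmem st7 0 3 = w2]]).
  apply: runs_rset_seq; apply: runs_rset_seq; apply: runs_rset.
  split=> /=; try by case: hsm6.
  by split=> /=; rewrite ?(sm_d hsm6) ?(sm_l hsm6) ?(sm_w hsm6) // /Phi expr2.
have [j2 [st8 [t8 [e8 ht8 hpost8]]]] := @runs_stage _ _ _ f X sigma hX hf hsigma m0 n0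
  delta k.+1%:R e Phi w2 e01 w2_gt0 Phi0 st7 n7 mm7 dl7 l7 ep7 Phi7 w7.
case: hpost8 => C8 [rem8 [w8 [W8 [Y08 [best8 [y8 [x8 [z8 [hst8 hsm8 hstop8]]]]]]]]].
case: hst8 => N8 [A8 [ys8 [Gs8 [G8 [J8 hst8]]]]].
have c0 : 0 < (phase_factor s)%:R :> R by apply: lt_le_trans c1.
have l1 : 1 <= k.+1%:R :> R by rewrite ler1n.
have hln : ln m%:R <= k.+1%:R :> R.
  by rewrite -ler_expR lnK ?posrE //; exact: nat_le_expR.
have cnt8 : j2%:R <= (n + m)%:R * k.+1%:R * c / delta ^+ 2.
  rewrite cE; exact: (refine_count hX m0 hs hd erefl c1 l1 hln erefl w2_gt0 hw1 hst8).
have [st9 [t9 [e9 ht9 [[i9 r9] x9]]]] :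
  runs f normalise_cmd st8 (3 * m + 2) 0 (fun st9 =>
    changed (fun b _ => b == 1%N) st8 st9 /\
    read_vec m st9 1 = \row_(r < m) (rmem st8 1 r / W8)).
  apply: (@runs_map _ _ _ f 1 _ (fun r => rmem st8 1 r / W8)).
    exact: sm_m hsm8.
  move=> r st rm h [_ hr] /=.
  by rewrite h !hr ?ltnn ?andbF // (sm_W hsm8).
have xE : read_vec m st9 1 = W8^-1 *: x8.
  by rewrite x9 -(sm_x hsm8); apply/rowP => r; rewrite !mxE mulrC.
have zE : read_vec m st9 2 = z8.
  by rewrite -(sm_z hsm8); apply: read_vec_ext => j; rewrite r9.
have [hz1 hz2] := exit_dual hX hsigma m0 e01 w2_gt0 hs hd erefl c0 l1 hln erefl
  hw1 hw2 hst8 hstop8.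
exists (W8^-1 *: x8), z8,
  (t1 + (t2 + t3) + (t4 + t5 + (t6 + (t7 + (t8 + t9)))).+1)%N, (n + (j1 + j2))%N.
split.
- exists st9; split=> //.
  have h := ExecSeq (ExecSeq e4 e5) (ExecSeq e6 (ExecSeq e7 (ExecSeq e8 e9))).
  rewrite !add0n !addn0 in h.
  by apply: (ExecSeq eprep (ExecIfTrue _ _ h)); rewrite /= D3.
- split=> //.
  + exact: (exit_mink hX e01 w2_gt0 hs c0 l1 erefl hw1 hst8 hstop8).
  + exact: (exit_norm hX hf hsigma m0 e01 w2_gt0 hs hd erefl c0 l1 hln erefl
      hw1 hw2 hst8 hstop8).
  + exact: (exit_lwd hX hf hsigma m0 e01 w2_gt0 hs hd erefl c0 l1 hln erefl
      hw1 hw2 hst8 hstop8).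
- apply: (calls_bound cE hkl) => //.
  by rewrite natrD natrD addrA lerD // lerD.
- by clear -ht ht4 ht5 ht6 ht7 ht8 ht9; lia.
Qed.

End Correctness.

(** With [B = n + m + 1 / delta], the calls contribute [B ^+ 4] (one factor each for [n + m] and
    [ln], two for [delta]), and the [O(m)] steps per call the fifth factor. *)
Lemma steps_poly (R : realType) (n m K q t : nat) (delta : R) :
  (0 < m)%N -> 0 < delta <= 1 ->
  q%:R <= K%:R * ((n + m)%:R / delta ^+ 2 * ln (maxn m 2)%:R) ->
  (t <= 60 * m.+1 * q.+1)%N ->
  t%:R <= (60 * K.+1)%:R * ((n + m)%:R + delta^-1) ^+ 5.
Proof.
move=> m0 /andP[d0 d1] hq ht.
have hD : 1 <= delta^-1 by rewrite -[leLHS]invr1 lef_pV2 ?posrE.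
set D := delta^-1 in hD *; set B := (n + m)%:R + D.
have nm : 1 <= (n + m)%:R :> R by rewrite ler1n; lia.
have B1 : 1 <= B by rewrite /B; lra.
have B0 : 0 <= B by apply: le_trans B1.
have hm : m.+1%:R <= B.
  by rewrite -natr1 /B lerD // ler_nat; lia.
have hln : ln (maxn m 2)%:R <= B.
  have M0 : 0 < (maxn m 2)%:R :> R by rewrite ltr0n; lia.
  apply: (@le_trans _ _ (maxn m 2)%:R).
    rewrite -ler_expR lnK ?posrE //; apply: le_trans (expR_ge1Dx _); lra.
  have h2 : 2 <= B by rewrite /B; lra.
  have h1 : m%:R <= B by apply: le_trans hm; rewrite ler_nat.
  by rewrite /maxn; case: ifP.
have l0 : 0 <= ln (maxn m 2)%:R :> R by rewrite ln_ge0 // ler1n; lia.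
have hq' : q.+1%:R <= K.+1%:R * B ^+ 4.
  rewrite -!natr1 mulrDl mul1r lerD ?exprn_ege1 //.
  apply: le_trans hq _; rewrite ler_wpM2l //.
  rewrite -exprVn -/D (_ : B ^+ 4 = B * B ^+ 2 * B); last by ring.
  have DB : D <= B by rewrite /B; lra.
  have D0 : 0 <= D by apply: le_trans hD.
  rewrite ler_pM // ?mulr_ge0 ?exprn_ge0 // ler_pM ?exprn_ge0 //.
    by rewrite /B; lra.
  by rewrite lerXn2r ?nnegrE.
apply: (@le_trans _ _ (60 * m.+1 * q.+1)%:R); first by rewrite ler_nat.
rewrite !natrM (_ : 60 * K.+1%:R * B ^+ 5 = 60 * B * (K.+1%:R * B ^+ 4)); last by ring.
by rewrite ler_pM ?mulr_ge0 // ler_pM2l.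
Qed.

Theorem theorem1 (R : realType) (sigma : R) (hsigma : 1 <= sigma) :
  exists (P : cmd) (K : R) (a k : nat),
  forall (n m : nat) (X : 'I_n -> set 'rV[R]_m)
         (f : 'I_n -> 'rV[R]_m -> 'rV[R]_m) (delta : R),
    (0 < m)%N -> rs_instance X -> block_solver sigma X f -> 0 < delta <= 1 ->
    exists (x z : 'rV[R]_m) (t q : nat),
      [/\ computes f P delta x z t q,
          minkowski_sum X x /\ simplex z,
          `|x| <= (1 + delta) * sigma * lambda_star X
            /\ min_dot (minkowski_sum X) z
                 >= (1 - delta) * (lambda_star X / sigma),
          forall (S : {set 'I_m}) (mu : R), 0 <= mu ->
            local_weak_duality f S mu ->
            \big[Num.max/0]_(r in S) x 0 r
              <= mu + delta * Num.max (lambda_star X) mu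
        & q%:R <= K * ((n + m)%:R / delta ^+ 2 * ln (maxn m 2)%:R)
            /\ t%:R <= a%:R * ((n + m)%:R + delta^-1) ^+ k].
Proof.
(* Programs contain only numerals as constants, so [sigma] enters through an integer upper bound, on
   which all constants depend. *)
pose s := Num.bound sigma.
have hs : sigma <= s%:R.
  by apply: ltW; apply: archi_boundP; apply: le_trans hsigma.
exists (program s), (call_constant s)%:R, (60 * (call_constant s).+1)%N, 5%N.
move=> n m X f delta m0 hX hf hd.
have [x [z [t [q [hc [hx hz hnorm hdual hlwd] hq ht]]]]] :=
  program_spec hX hf hsigma hs m0 hd.
exists x, z, t, q; split=> //; split=> //.
exact: steps_poly m0 hd hq ht.
Qed.
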